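(* Suppose $\min\{d_1,\dots,d_{L-1}\}\ge d_{\min}$, and: if $L=2$, $\lambda\ne y_i^2$ for all $i\in[r_Y]$; if $L\ge3$, $\lambda\ne y_i^{2(L-1)}\big((\tfrac{L-2}L)^{\frac{L}{2(L-1)}}+(\tfrac L{L-2})^{\frac{L-2}{2(L-1)}}\big)^{-2(L-1)}$ for all $i\in[r_Y]$. Then for every $\bm\sigma^*\in\mathcal A_{\rm sort}\setminus\{\bm0\}$ there exist constants $\epsilon_{\bm\sigma^*},\kappa_{\bm\sigma^*}>0$ (depending only on $L$, $\lambda$, $y_1,\dots,y_{d_{\min}}$, $d_0,\dots,d_L$ and $\bm\sigma^*$) such that for all $\bm W$ with $\mathrm{dist}(\bm W,\mathcal W_{\bm\sigma^*})\le\epsilon_{\bm\sigma^*}$, $$\mathrm{dist}(\bm W,\mathcal W_{\bm\sigma^*})\le\kappa_{\bm\sigma^*}\|\nabla G(\bm W)\|_F.$$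
   Context: Setting as in Lemma 3.5: $L\ge2$, $d_{\min}=\min\{d_0,d_L\}$, $\lambda>0$, $\bm Y\in\mathbb R^{d_L\times d_0}$ diagonal with entries $y_1\ge\dots\ge y_{d_{\min}}\ge0$, $r_Y$ the number of positive $y_i$; $G(\bm W)=\|\bm W_L\cdots\bm W_1-\sqrt\lambda\bm Y\|_F^2+\lambda\sum_l\|\bm W_l\|_F^2$ for $\bm W_l\in\mathbb R^{d_l\times d_{l-1}}$; $\mathcal A=\{\bm a\in\mathbb R^{d_{\min}}:a_i^{2L-1}-\sqrt\lambda y_ia_i^{L-1}+\lambda a_i=0,a_i\ge0\}$; $\mathcal A_{\rm sort}$ the set of nonincreasing rearrangements $\bm\sigma=\bm\Pi\bm a$ of elements $\bm a\in\mathcal A$; $\mathcal W_{\bm\sigma^*}$ the set of tuples $\bm W_1=\bm Q_2\bm\Sigma_1\mathrm{BlkD}(\bm\Pi,\bm I)\mathrm{BlkD}(\bm O_1,\dots,\bm O_{p_Y+1})$, $\bm W_l=\bm Q_{l+1}\bm\Sigma_l\bm Q_l^T$ ($2\le l\le L-1$), $\bm W_L=\mathrm{BlkD}(\bm O_1^T,\dots,\bm O_{p_Y}^T,\widehat{\bm O}_{p_Y+1}^T)\mathrm{BlkD}(\bm\Pi^T,\bm I)\bm\Sigma_L\bm Q_L^T$, where $\bm\Sigma_l\in\mathbb R^{d_l\times d_{l-1}}$ has top-left block $\mathrm{diag}(\bm\sigma^* )$, $\bm\Pi$ is a permutation with $\bm\Pi^T\bm\sigma^*\in\mathcal A$, and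 $\bm Q_l\in\mathcal O^{d_{l-1}}$, $\bm O_k\in\mathcal O^{h_k}$ ($h_k$ the multiplicities of the $p_Y$ distinct positive values among the $y_i$), $\bm O_{p_Y+1}\in\mathcal O^{d_0-r_Y}$, $\widehat{\bm O}_{p_Y+1}\in\mathcal O^{d_L-r_Y}$ range over all orthogonal matrices. Distances and gradient norms are Frobenius norms on tuples. *)

(* Defs.v *)
From HB Require Import structures.
From mathcomp Require Import all_boot all_order all_fingroup all_algebra.
From mathcomp Require Import all_classical all_reals all_analysis.
Set Implicit Arguments. Unset Strict Implicit. Unset Printing Implicit Defensive.
Import Order.TTheory GRing.Theory Num.Theory.
Import numFieldNormedType.Exports.
Local Open Scope ring_scope.
Local Open Scope classical_set_scope.

Section DeepLinear.
Variable R : realType.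

Definition orthomx (k : nat) (M : 'M[R]_k) : Prop := M *m M^T = 1%:M.

(* Weight tuples.  Dimensions d_0, d_1, ... are given by d : nat -> nat.
   W l : 'M_(d (l+1), d l) is the paper's W_{l+1}; only l < L matters. *)
Definition wtuple (d : nat -> nat) := forall l : nat, 'M[R]_(d l.+1, d l).

Definition frob2 (p q : nat) (M : 'M[R]_(p, q)) : R :=
  \sum_(i < p) \sum_(j < q) M i j ^+ 2.

Definition frobdot (p q : nat) (M N : 'M[R]_(p, q)) : R :=
  \sum_(i < p) \sum_(j < q) M i j * N i j.

Variables (d : nat -> nat) (L : nat).

Definition tnorm (W : wtuple d) : R := Num.sqrt (\sum_(l < L) frob2 (W l)).

Definition tdist (W V : wtuple d) : R := tnorm (fun l => W l - V l).

Definition tdot (W V : wtuple d) : R := \sum_(l < L) frobdot (W l) (V l).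

Definition dist_set (W : wtuple d) (S : set (wtuple d)) : R :=
  inf [set tdist W V | V in S].

Fixpoint prodW (W : wtuple d) (k : nat) : 'M[R]_(d k, d 0) :=
  match k return 'M[R]_(d k, d 0) with
  | 0 => 1%:M
  | k'.+1 => W k' *m prodW W k'
  end.

Definition is_grad (F : wtuple d -> R) (W Gr : wtuple d) : Prop :=
  forall V : wtuple d,
    is_derive (0 : R) (1 : R) (fun t : R => F (fun l => W l + t *: V l)) (tdot Gr V).

End DeepLinear.

Definition diagY (R : realType) (p q : nat) (y : nat -> R) : 'M[R]_(p, q) :=
  \matrix_(i, j) (if (i == j :> nat) then y (nat_of_ord i) else 0).

Definition Gobj (R : realType) (d : nat -> nat) (n : nat) (lam : R) (y : nat -> R)
  (W : wtuple R d) : R :=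
  frob2 (prodW W n.+2 - Num.sqrt lam *: diagY (d n.+2) (d 0) y)
  + lam * \sum_(l < n.+2) frob2 (W l).

Definition setA (R : realType) (L dmin : nat) (lam : R) (y : nat -> R) : set 'cV[R]_dmin :=
  [set a | forall i : 'I_dmin,
     a i 0 ^+ (2 * L - 1) - Num.sqrt lam * y i * a i 0 ^+ (L - 1) + lam * a i 0 = 0
     /\ 0 <= a i 0].

Definition setAsort (R : realType) (L dmin : nat) (lam : R) (y : nat -> R) : set 'cV[R]_dmin :=
  [set sig | exists a, exists s : {perm 'I_dmin},
     setA L lam y a /\ sig = perm_mx s *m a /\
     (forall i j : 'I_dmin, (i <= j)%N -> sig j 0 <= sig i 0)].

Definition rY (R : realType) (dmin : nat) (y : nat -> R) : nat :=
  count (fun i => 0 < y i) (iota 0 dmin).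

Definition Sigmx (R : realType) (k p q : nat) (sig : 'cV[R]_k) : 'M[R]_(p, q) :=
  \matrix_(i, j) (if (i == j :> nat) then oapp (fun i' : 'I_k => sig i' 0) 0 (insub (val i))
                  else 0).

Definition blkI (R : realType) (k m : nat) (P : 'M[R]_k) : 'M[R]_m :=
  \matrix_(i, j) (match insub (val i), insub (val j) with
                  | Some i', Some j' => P i' j'
                  | _, _ => ((val i == val j)%N)%:R
                  end).

(* Indices i, j lie in the same diagonal block of BlkD(O_1,...,O_{p_Y}, O_{p_Y+1}):
   the first p_Y blocks group the indices < r_Y with equal (positive) y-value
   (consecutive, since y is sorted), the last block is the indices >= r_Y. *)
Definition same_blk (R : realType) (r : nat) (y : nat -> R) (i j : nat) : bool :=
  if (i < r)%N && (j < r)%N then y i == y j else (r <= i)%N && (r <= j)%N.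

Definition blkdiag_y (R : realType) (r : nat) (y : nat -> R) (m : nat) (O : 'M[R]_m) : Prop :=
  forall i j : 'I_m, ~~ same_blk r y i j -> O i j = 0.

(* The set W_{sigma*} (L = n+2).  Q l (1 <= l <= n+1) is the paper's Q_{l+1};
   O = BlkD(O_1,...,O_{p_Y+1}) and Oh = BlkD(O_1,...,O_{p_Y},\hat O_{p_Y+1}),
   sharing the first p_Y blocks. *)
Definition setWsig (R : realType) (d : nat -> nat) (n : nat) (lam : R) (y : nat -> R)
  (sig : 'cV[R]_(minn (d 0) (d n.+2))) : set (wtuple R d) :=
  let dmin := minn (d 0) (d n.+2) in
  let r := rY dmin y in
  [set W : wtuple R d | exists (s : {perm 'I_dmin}) (Q : forall l : nat, 'M[R]_(d l))
                  (O : 'M[R]_(d 0)) (Oh : 'M[R]_(d n.+2)),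
     setA n.+2 lam y ((perm_mx s)^T *m sig) /\
         (forall l, (1 <= l <= n.+1)%N -> orthomx (Q l)) /\
         orthomx O /\ blkdiag_y r y O /\
         orthomx Oh /\ blkdiag_y r y Oh /\
         (forall (i j : 'I_(d 0)) (i' j' : 'I_(d n.+2)),
            val i = val i' -> val j = val j' -> (i < r)%N -> (j < r)%N -> O i j = Oh i' j') /\
         W 0 = Q 1 *m Sigmx _ _ sig *m blkI _ (perm_mx s) *m O /\
         (forall l, (1 <= l <= n)%N -> W l = Q l.+1 *m Sigmx _ _ sig *m (Q l)^T) /\
         W n.+1 = Oh^T *m blkI _ (perm_mx s)^T *m Sigmx _ _ sig *m (Q n.+1)^T].

Arguments setWsig {R} d n lam y sig.
Arguments Gobj {R} d n lam y W.

(* Main.v *)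
(* [setWsig] is a finite union of orbits of a group of isometries preserving the
   objective [Gobj]: a tuple lies in it iff it is [l |-> U_{l+1} diag(a) U_l^T] for
   some [a] in the critical set and orthogonal [U_l] with [U_L Y = Y U_0].  Given [W],
   choose [V] in the set with [|W - V|^2 <= dist^2 + dist^4] (so that no compactness
   is needed) and move [V] to the diagonal tuple; then [H = W - V] is orthogonal to
   the orbit up to [O(|H|^2)], which is tested on plane rotations only.

   Modulo [O(|grad| + |H|^2)], the entries [H_l i j] and [H_l j i] satisfy a linear
   system.  The balance identity
   [W_{l+1}^T G_{l+1} - G_l W_l^T = 2 lam (W_{l+1}^T W_{l+1} - W_l W_l^T)] and
   orthogonality give [a_j H_l i j = a_i H_{l+1} i j]; the symmetry of [Y M^T] and
   [M^T Y] for the end-to-end product [M] relates the first layer to the last one.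
   This kills everything except the indices with [a_i = a_j], on which the linearized
   gradient is invertible: the hypothesis on [lam] says that [a_i] is a simple root of
   [a^(2L-1) - sqrt lam y_i a^(L-1) + lam a].
   Hence [|H| <= C (|grad| + |H|^2)], and the quadratic term is absorbed. *)

Require Import Defs.
From HB Require Import structures.
From mathcomp Require Import all_boot all_order all_fingroup all_algebra.
From mathcomp Require Import all_classical all_reals all_analysis.
From mathcomp Require Import ring lra zify.
Import Order.TTheory GRing.Theory Num.Theory.
Import numFieldNormedType.Exports.
Local Open Scope ring_scope.
Local Open Scope classical_set_scope.

Set Implicit Arguments.
Unset Strict Implicit.
Unset Printing Implicit Defensive.

(** Tangent directions of the orbit lie in the kernel of the linearized gradient; only orthogonality
    can exclude them, and it is needed with an error [O(|H|^2)]. This fixes the slack: a rotation by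
    an angle of order [t] changes the squared distance by a term linear in [t] plus [O(t^2)], so a
    point that is minimal up to [s] is orthogonal up to [O(sqrt s)], whence a slack of fourth order.

    At a diagonal point every linearized relation couples the entries at [i j] only with those at
    [j i]. No operator has to be inverted globally: each pair gives a scalar recursion along the
    layers, closed by one or two scalar equations.

    The constant obtained depends on the diagonal [a] only, since gradient and distance are
    conjugated together with the orbit point; and the diagonals that occur are indexed by the
    finitely many permutations. *)

(** * Domination up to a constant, and first-order expansions of matrix families *)

Section Dominated.
Context (R : realType) (T : Type).
Implicit Types (w f g : T -> R) (c : R).

(** A big-O over a bare index type rather than along a filter: constants stay existential throughout
    the linear algebra, and their uniformity is decided by what [T] contains. *)
Definition dom w f := exists C : R, forall t, `|f t| <= C * w t.

Lemma dom_lin1 w f g c : dom w f -> (forall t, g t = c * f t) -> dom w g.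
Proof.
move=> [C hC] e; exists (`|c| * C) => t.
by rewrite e normrM -mulrA ler_wpM2l.
Qed.

Lemma dom_ext w f g : dom w f -> (forall t, g t = f t) -> dom w g.
Proof. by move=> h e; apply: (dom_lin1 (c := 1) h) => t; rewrite mul1r. Qed.

Lemma domD w f g : dom w f -> dom w g -> dom w (fun t => f t + g t).
Proof.
move=> [C hC] [C' hC']; exists (C + C') => t.
by rewrite mulrDl (le_trans (ler_normD _ _)) // lerD.
Qed.

Lemma dom_lin2 w f1 f2 g c1 c2 : dom w f1 -> dom w f2 ->
  (forall t, g t = c1 * f1 t + c2 * f2 t) -> dom w g.
Proof.
move=> h1 h2; apply: dom_ext.
by apply: domD; [apply: (dom_lin1 h1)|apply: (dom_lin1 h2)].
Qed.

Lemma dom_lin3 w f1 f2 f3 g c1 c2 c3 : dom w f1 -> dom w f2 -> dom w f3 ->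
  (forall t, g t = c1 * f1 t + c2 * f2 t + c3 * f3 t) -> dom w g.
Proof.
move=> h1 h2 h3 e.
apply: (dom_lin2 (c1 := 1) (c2 := c3) (dom_lin2 h1 h2 (fun=> erefl)) h3) => t.
by rewrite mul1r e.
Qed.

Lemma dom0 w : dom w (fun=> 0).
Proof. by exists 0 => t; rewrite normr0 mul0r. Qed.

Lemma dom_sum w (I : Type) (r : seq I) (P : pred I) (F : I -> T -> R) :
  (forall i, P i -> dom w (F i)) -> dom w (fun t => \sum_(i <- r | P i) F i t).
Proof.
move=> h; elim: r => [|i r IH].
  by apply: (dom_ext (dom0 w)) => t; rewrite big_nil.
have [Pi|nPi] := boolP (P i).
  by apply: (dom_ext (domD (h i Pi) IH)) => t; rewrite big_cons Pi.
by apply: (dom_ext IH) => t; rewrite big_cons (negPf nPi).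
Qed.

Lemma dom_le w1 w2 f c : (forall t, 0 <= w1 t) -> (forall t, w1 t <= c * w2 t) ->
  dom w1 f -> dom w2 f.
Proof.
move=> h0 h [C hC]; exists (`|C| * c) => t; apply: (le_trans (hC t)).
rewrite -mulrA (le_trans (ler_wpM2r (h0 t) (ler_norm C))) //.
by rewrite ler_wpM2l.
Qed.

Lemma domM w1 w2 f g : dom w1 f -> dom w2 g ->
  dom (fun t => w1 t * w2 t) (fun t => f t * g t).
Proof.
move=> [C hC] [C' hC']; exists (C * C') => t.
by rewrite normrM mulrACA ler_pM.
Qed.

Definition mdom w p q (M : T -> 'M[R]_(p, q)) := forall i j, dom w (fun t => M t i j).

Lemma mdom_ext w p q (M M' : T -> 'M[R]_(p, q)) :
  mdom w M -> (forall t, M' t = M t) -> mdom w M'.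
Proof. by move=> h e i j; apply: (dom_ext (h i j)) => t; rewrite e. Qed.

Lemma mdomD w p q (M M' : T -> 'M[R]_(p, q)) :
  mdom w M -> mdom w M' -> mdom w (fun t => M t + M' t).
Proof. by move=> h h' i j; apply: (dom_ext (domD (h i j) (h' i j))) => t; rewrite mxE. Qed.

Lemma mdomZ w p q (M : T -> 'M[R]_(p, q)) c :
  mdom w M -> mdom w (fun t => c *: M t).
Proof. by move=> h i j; apply: (dom_lin1 (h i j)) => t; rewrite mxE. Qed.

Lemma mdomB w p q (M M' : T -> 'M[R]_(p, q)) :
  mdom w M -> mdom w M' -> mdom w (fun t => M t - M' t).
Proof.
move=> h h'; apply: (mdom_ext (mdomD h (mdomZ (-1) h'))) => t.
by rewrite scaleN1r.
Qed.

Lemma mdom_tr w p q (M : T -> 'M[R]_(p, q)) : mdom w M -> mdom w (fun t => (M t)^T).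
Proof. by move=> h i j; apply: (dom_ext (h j i)) => t; rewrite mxE. Qed.

Lemma mdomM w1 w2 p q r (M : T -> 'M[R]_(p, q)) (M' : T -> 'M[R]_(q, r)) :
  mdom w1 M -> mdom w2 M' -> mdom (fun t => w1 t * w2 t) (fun t => M t *m M' t).
Proof.
move=> h h' i j.
apply: (dom_ext (f := fun t => \sum_k M t i k * M' t k j)).
  by apply: dom_sum => k _; apply: domM.
by move=> t; rewrite mxE.
Qed.

Lemma mdom_le w1 w2 p q (M : T -> 'M[R]_(p, q)) c : (forall t, 0 <= w1 t) ->
  (forall t, w1 t <= c * w2 t) -> mdom w1 M -> mdom w2 M.
Proof. by move=> h0 h hM i j; apply: (dom_le h0 h). Qed.

Lemma mdom_cst p q (M : 'M[R]_(p, q)) : mdom (fun=> 1) (fun=> M).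
Proof. by move=> i j; exists `|M i j| => t; rewrite mulr1. Qed.

Context (h delta : T -> R).
Hypotheses (h_ge0 : forall t, 0 <= h t) (h_le1 : forall t, h t <= 1)
  (h_sqr : forall t, h t ^+ 2 <= delta t).

Let delta_ge0 t : 0 <= delta t.
Proof. by rewrite (le_trans _ (h_sqr t)) // sqr_ge0. Qed.

Lemma mdom_small_bd p q r (M : T -> 'M[R]_(p, q)) (M' : T -> 'M[R]_(q, r)) :
  mdom delta M -> mdom (fun=> 1) M' -> mdom delta (fun t => M t *m M' t).
Proof.
move=> hM hM'; apply: (mdom_le (c := 1) _ _ (mdomM hM hM')) => t.
  by rewrite mulr1.
by rewrite mulr1 mul1r.
Qed.

Lemma mdom_bd_small p q r (M : T -> 'M[R]_(p, q)) (M' : T -> 'M[R]_(q, r)) :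
  mdom (fun=> 1) M -> mdom delta M' -> mdom delta (fun t => M t *m M' t).
Proof.
move=> hM hM'; apply: (mdom_le (c := 1) _ _ (mdomM hM hM')) => t.
  by rewrite mul1r.
by rewrite !mul1r.
Qed.

(* [h] is the scale of first-order terms, [delta] that of the discarded ones. *)
Definition expands p q (M : T -> 'M[R]_(p, q)) (M0 : 'M[R]_(p, q))
    (M1 : T -> 'M[R]_(p, q)) :=
  [/\ mdom (fun=> 1) M, mdom h M1 & mdom delta (fun t => M t - M0 - M1 t)].

Lemma mdom_h_bd p q (M : T -> 'M[R]_(p, q)) : mdom h M -> mdom (fun=> 1) M.
Proof. by apply: (mdom_le (c := 1)) => // t; rewrite mulr1. Qed.

(** Product rule: besides the errors of the factors, the only term beyond first order is
    [M1 t *m M1' t], of size [h ^+ 2], which [h_sqr] absorbs into [delta]. *)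
Lemma expandsM p q r (M : T -> 'M[R]_(p, q)) M0 M1 (M' : T -> 'M[R]_(q, r)) M0' M1' :
  expands M M0 M1 -> expands M' M0' M1' ->
  expands (fun t => M t *m M' t) (M0 *m M0') (fun t => M1 t *m M0' + M0 *m M1' t).
Proof.
move=> [bM fM sM] [bM' fM' sM']; split.
- by apply: (mdom_le (c := 1) _ _ (mdomM bM bM')) => t; rewrite !mulr1.
- apply: mdomD.
    apply: (mdom_le (c := 1) _ _ (mdomM fM (mdom_cst M0'))) => t; first by rewrite mulr1.
    by rewrite mulr1 mul1r.
  apply: (mdom_le (c := 1) _ _ (mdomM (mdom_cst M0) fM')) => t; first by rewrite mul1r.
  by rewrite !mul1r.
apply: (mdom_ext (M := fun t => (M t - M0 - M1 t) *m M' t +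
   (M0 + M1 t) *m (M' t - M0' - M1' t) + M1 t *m M1' t)).
  apply: mdomD; first apply: mdomD.
  - exact: mdom_small_bd.
  - by apply: mdom_bd_small => //; apply: mdomD; [apply: mdom_cst|apply: mdom_h_bd].
  - apply: (mdom_le (c := 1) _ _ (mdomM fM fM')) => t; first by rewrite mulr_ge0.
    by rewrite mul1r -expr2.
move=> t; rewrite !(mulmxDl, mulmxDr, mulmxBl, mulmxBr, mulNmx, mulmxN).
apply/matrixP => i j; rewrite !mxE; ring.
Qed.

Lemma expandsD p q (M : T -> 'M[R]_(p, q)) M0 M1 M' M0' M1' :
  expands M M0 M1 -> expands M' M0' M1' ->
  expands (fun t => M t + M' t) (M0 + M0') (fun t => M1 t + M1' t).
Proof.
move=> [bM fM sM] [bM' fM' sM']; split; [exact: mdomD|exact: mdomD|].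
apply: (mdom_ext (mdomD sM sM')) => t.
by apply/matrixP => i j; rewrite !mxE; ring.
Qed.

Lemma expandsZ p q (M : T -> 'M[R]_(p, q)) M0 M1 c :
  expands M M0 M1 -> expands (fun t => c *: M t) (c *: M0) (fun t => c *: M1 t).
Proof.
move=> [bM fM sM]; split; [exact: mdomZ|exact: mdomZ|].
apply: (mdom_ext (mdomZ c sM)) => t.
by apply/matrixP => i j; rewrite !mxE; ring.
Qed.

Lemma expands_tr p q (M : T -> 'M[R]_(p, q)) M0 M1 :
  expands M M0 M1 -> expands (fun t => (M t)^T) M0^T (fun t => (M1 t)^T).
Proof.
move=> [bM fM sM]; split; [exact: mdom_tr|exact: mdom_tr|].
apply: (mdom_ext (mdom_tr sM)) => t.
by apply/matrixP => i j; rewrite !mxE; ring.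
Qed.

Lemma expands_cst p q (M : 'M[R]_(p, q)) : expands (fun=> M) M (fun=> 0).
Proof.
split; first exact: mdom_cst.
  by move=> i j; apply: (dom_ext (dom0 _)) => t; rewrite mxE.
by move=> i j; apply: (dom_ext (dom0 _)) => t; rewrite !mxE; ring.
Qed.

(** The device by which an exact identity between weights and gradient becomes a linear relation
    between entries of [H], valid modulo [delta]. *)
Lemma expands_small p q (M : T -> 'M[R]_(p, q)) M0 M1 i j : expands M M0 M1 ->
  mdom delta M -> M0 i j = 0 -> dom delta (fun t => M1 t i j).
Proof.
move=> [_ _ sM] sM' z.
apply: (dom_lin2 (c1 := 1) (c2 := -1) (sM' i j) (sM i j)) => t.
by rewrite !mxE z; ring.
Qed.

Lemma expands_perturb p q (M0 : 'M[R]_(p, q)) M1 : mdom h M1 ->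
  expands (fun t => M0 + M1 t) M0 M1.
Proof.
move=> f; split=> //; first by apply: mdomD; [exact: mdom_cst|exact: mdom_h_bd].
by move=> i j; apply: (dom_ext (dom0 _)) => t; rewrite !mxE; ring.
Qed.

End Dominated.

(** * Products of consecutive layers *)

Section Segments.
Context (R : pzRingType) (N : nat).
Implicit Types w : nat -> 'M[R]_N.

(** The product [w (m + k - 1) ... w m], given by start and length so that a factor can be split off
    on either side: on the left by definition, on the right by [segwS]. *)
Fixpoint segw w m k : 'M[R]_N :=
  if k is k'.+1 then w (m + k')%N *m segw w m k' else 1%:M.

Lemma segwS w m k : segw w m k.+1 = segw w m.+1 k *m w m.
Proof.
elim: k => [|k IH]; first by rewrite /= addn0 mulmx1 mul1mx.
by rewrite [LHS]/= -[_ *m segw _ _ _]/(segw w m k.+1) IH mulmxA /= addnS.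
Qed.

Lemma eq_segw w w' m k : (forall l, (m <= l < m + k)%N -> w l = w' l) ->
  segw w m k = segw w' m k.
Proof.
elim: k => //= k IH e; rewrite e ?IH //; last by lia.
by move=> l hl; apply: e; lia.
Qed.

End Segments.

(** Multiplying the gradient of an end layer by the transpose of that layer gives two Gram matrices,
    in the roles of [A] and [B], and one product with the target, [C]. Antisymmetrizing keeps only
    the last. *)
Lemma antisym_part (R : realType) N (l : R) (A B C : 'M[R]_N) : A^T = A -> B^T = B ->
  - 2^-1 *: (2 *: (A - C + l *: B) - (2 *: (A - C + l *: B))^T) = C + -1 *: C^T.
Proof.
move=> hA hB; apply/matrixP => i j.
have eA : A j i = A i j by rewrite -{1}hA mxE.
have eB : B j i = B i j by rewrite -{1}hB mxE.
by rewrite !mxE eA eB; lra.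
Qed.

(** * The linearized system at a diagonal critical point *)

Section Core.
Context (R : realType) (N n : nat) (lam : R) (a v : 'rV[R]_N).
Context (T : Type) (h delta : T -> R) (H W g : T -> nat -> 'M[R]_N)
  (E : T -> 'M[R]_N).

Local Notation D := (diag_mx a).
Local Notation α i := (a 0 i).
Local Notation dm := (dom delta).

Definition diagX k : 'M[R]_N := diag_mx (\row_i a 0 i ^+ k).

(** First variation of the segment at the diagonal point: one factor becomes [H], the factors on its
    left contribute powers of [α i], those on its right powers of [α j]. *)
Definition segw1 t m k : 'M[R]_N :=
  \matrix_(i, j) \sum_(l < k) α i ^+ (k.-1 - l) * H t (m + l)%N i j * α j ^+ l.


(** [v] is the diagonal of the scaled target and [E] the residual. [crit] is the critical equation;
    [nondeg_pos] says that [a ^+ n.+2 + lam / a ^+ n] is not stationary at [α i], and [nondeg_zero]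
    is the simplicity of the root zero for two layers. [orth_mid] comes from rotating one inner
    space, [orth_end] from rotating the two outer spaces together. *)
Hypotheses (h_ge0 : forall t, 0 <= h t) (h_le1 : forall t, h t <= 1)
  (h_sqr : forall t, h t ^+ 2 <= delta t)
  (lam_gt0 : 0 < lam) (a_ge0 : forall i, 0 <= α i) (v_ge0 : forall i, 0 <= v 0 i)
  (crit : forall i, α i ^+ n.+1 * (α i ^+ n.+2 - v 0 i) + lam * α i = 0)
  (nondeg_pos : forall i, 0 < α i -> n.+2%:R * α i ^+ (2 * n.+1) != n%:R * lam)
  (nondeg_zero : n = 0%N -> forall i, lam ^+ 2 != v 0 i ^+ 2)
  (H_small : forall l, (l < n.+2)%N -> mdom h (fun t => H t l))
  (g_small : forall l, (l < n.+2)%N -> mdom delta (fun t => g t l))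
  (WE : forall t l, (l < n.+2)%N -> W t l = D + H t l)
  (EE : forall t, E t = segw (W t) 0 n.+2 - diag_mx v)
  (gE : forall t l, (l < n.+2)%N -> g t l =
     2 *: ((segw (W t) l.+1 (n.+1 - l))^T *m E t *m (segw (W t) 0 l)^T + lam *: W t l))
  (orth_mid : forall l i j, (l < n.+1)%N -> dm (fun t =>
     H t l i j * α j - α i * H t l.+1 i j - (H t l j i * α i - α j * H t l.+1 j i)))
  (orth_end : forall i j, 0 < v 0 i -> v 0 i = v 0 j -> dm (fun t =>
     α i * H t 0 i j - α j * H t 0 j i - (α j * H t n.+1 i j - α i * H t n.+1 j i))).

Local Notation exps := (expands h delta).

Lemma expands_layer l : (l < n.+2)%N -> exps (fun t => W t l) D (fun t => H t l).
Proof.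
move=> hl; have -> : W^~ l = fun t => D + H t l by apply/funext => t; exact: WE.
by apply: expands_perturb => //; apply: H_small.
Qed.

Lemma expands_segw m k : (m + k <= n.+2)%N ->
  exps (fun t => segw (W t) m k) (diagX k) (fun t => segw1 t m k).
Proof.
elim: k => [|k IH] hk.
  have -> : diagX 0 = 1%:M by apply/matrixP => i j; rewrite !mxE expr0.
  have -> : (fun t => segw1 t m 0) = (fun=> 0).
    by apply/funext => t; apply/matrixP => i j; rewrite !mxE big_ord0.
  exact: expands_cst.
have := expandsM h_ge0 h_le1 h_sqr (@expands_layer (m + k)%N ltac:(lia)) (IH ltac:(lia)).
have -> : D *m diagX k = diagX k.+1.
  by apply/matrixP => i j; rewrite mul_diag_mx !mxE mulrnAr exprS.
have -> // : (fun t => H t (m + k)%N *m diagX k + D *m segw1 t m k) =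
             (fun t => segw1 t m k.+1).
apply/funext => t; apply/matrixP => i j.
rewrite mul_mx_diag mul_diag_mx !mxE big_ord_recr /= subnn expr0 mul1r addrC.
congr (_ + _); rewrite mulr_sumr; apply: eq_bigr => l _.
rewrite !mulrA -exprS; congr (_ ^+ _ * _ * _).
by case: k l {IH hk} => [[]//|k] l /=; have := ltn_ord l; lia.
Qed.

(** The residual enters [W_{l+1}^T g_{l+1}] and [g_l W_l^T] through the same product of segments and
    cancels in the difference. What remains is the regularization, whose zero-order part vanishes
    because [D] is symmetric and is shared by both layers. *)
Lemma balance_lin l i j : (l < n.+1)%N ->
  dm (fun t => α i * H t l.+1 i j + H t l.+1 j i * α j - H t l i j * α j - α i * H t l j i).
Proof.
move=> hl.
have el := expands_layer (ltnW hl : (l < n.+2)%N).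
have el1 := expands_layer (hl : (l.+1 < n.+2)%N).
have X := expandsD (expandsM h_ge0 h_le1 h_sqr (expands_tr el1) el1)
  (expandsZ (-1) (expandsM h_ge0 h_le1 h_sqr el (expands_tr el))).
have sm : mdom delta (fun t => (W t l.+1)^T *m W t l.+1 + -1 *: (W t l *m (W t l)^T)).
  have sg : mdom delta (fun t => (W t l.+1)^T *m g t l.+1 - g t l *m (W t l)^T).
    apply: mdomB.
      apply: (mdom_bd_small h_sqr); last exact: g_small.
      by apply: mdom_tr; case: el1.
    apply: (mdom_small_bd h_sqr); first exact: g_small (ltnW hl).
    by apply: mdom_tr; case: el.
  apply: (mdom_ext (mdomZ (2 * lam)^-1 sg)) => t.
  rewrite !gE ?ltnS ?(ltnW hl) // -scalemxAr -scalemxAl -scalerBr.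
  have -> : (n.+1 - l = (n.+1 - l.+1).+1)%N by lia.
  rewrite (segwS _ l.+1) /= add0n !trmx_mul mulmxDr mulmxDl !mulmxA.
  rewrite opprD addrACA subrr add0r.
  rewrite -scalemxAr -scalemxAl -scalerBr !scalerA scaleN1r mulVf ?scale1r //.
  by rewrite mulf_neq0 // lt0r_neq0.
have z : (D^T *m D + -1 *: (D *m D^T)) i j = 0.
  by rewrite tr_diag_mx scaleN1r subrr mxE.
apply: (dom_ext (expands_small X sm z)) => t.
rewrite tr_diag_mx !(mul_mx_diag, mul_diag_mx) !mxE; ring.
Qed.

(** Let [x_ij] be the quantity to bound. [balance_lin] controls [x_ij + x_ji], and [orth_mid]
    controls [x_ij - x_ji]. *)
Lemma shift_lin l i j : (l < n.+1)%N -> dm (fun t => H t l i j * α j - α i * H t l.+1 i j).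
Proof.
move=> hl; apply: (dom_lin2 (c1 := 2^-1) (c2 := - 2^-1) (orth_mid i j hl)
  (balance_lin i j hl)) => t; lra.
Qed.

Lemma shift_iter l i j : (l < n.+2)%N ->
  dm (fun t => α i ^+ l * H t l i j - α j ^+ l * H t 0 i j).
Proof.
elim: l => [|l IH] hl; first by apply: (dom_ext (dom0 _)) => t; ring.
apply: (dom_lin2 (c1 := α j) (c2 := - α i ^+ l) (IH (ltnW hl)) (shift_lin i j hl)) => t.
by rewrite !exprS; ring.
Qed.

Lemma shift_iter_rev l i j : (l < n.+2)%N ->
  dm (fun t => α j ^+ (n.+1 - l) * H t l i j - α i ^+ (n.+1 - l) * H t n.+1 i j).
Proof.
move=> hl; have -> : l = (n.+1 - (n.+1 - l))%N by lia.
rewrite subKn; last by lia.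
have : (n.+1 - l < n.+2)%N by lia.
elim: (n.+1 - l)%N => [|k IH] hk; first by apply: (dom_ext (dom0 _)) => t; rewrite subn0; ring.
have hk' : (n.+1 - k.+1 < n.+1)%N by lia.
have := shift_lin i j hk'; have -> : (n.+1 - k.+1).+1 = (n.+1 - k)%N by lia.
move=> X; apply: (dom_lin2 (c1 := α i) (c2 := α j ^+ k) (IH (ltnW hk)) X) => t.
by rewrite !exprS; ring.
Qed.

Let P t := segw (W t) 0 n.+2.
Local Notation P1 t := (segw1 t 0 n.+2).

Lemma expands_P : exps P (diagX n.+2) (fun t => P1 t).
Proof. exact: expands_segw. Qed.

Lemma mulX_diag k (u : 'rV[R]_N) : diagX k *m diag_mx u = diag_mx u *m diagX k.
Proof.
apply/matrixP => i j; rewrite mul_diag_mx mul_mx_diag !mxE.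
by case: eqP => [->|_]; rewrite ?mulr1n ?mulr0n; ring.
Qed.

Lemma prod_sym_lin i j : dm (fun t => v 0 i * P1 t j i - P1 t i j * v 0 j).
Proof.
have cv := expands_cst h delta (diag_mx v).
have X := expandsD (expandsM h_ge0 h_le1 h_sqr cv (expands_tr expands_P))
  (expandsZ (-1) (expandsM h_ge0 h_le1 h_sqr expands_P cv)).
have eL := expands_layer (ltnSn n.+1).
have sm : mdom delta (fun t => diag_mx v *m (P t)^T + -1 *: (P t *m diag_mx v)).
  have sg : mdom delta (fun t => g t n.+1 *m (W t n.+1)^T).
    apply: (mdom_small_bd h_sqr); first exact: g_small.
    by apply: mdom_tr; case: eL.
  apply: (mdom_ext (mdomZ (-2^-1) (mdomB sg (mdom_tr sg)))) => t.
  have -> : g t n.+1 *m (W t n.+1)^T = 2 *: (E t *m (P t)^T + lam *: (W t n.+1 *m (W t n.+1)^T)).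
    rewrite gE // subnn trmx1 mul1mx -scalemxAl mulmxDl -scalemxAl; congr (_ *: (_ + _)).
    by rewrite -mulmxA -trmx_mul.
  rewrite EE -[segw _ _ _]/(P t) mulmxBl antisym_part ?trmx_mul ?trmxK //.
  by rewrite tr_diag_mx.
have z : (diag_mx v *m (diagX n.+2)^T + -1 *: (diagX n.+2 *m diag_mx v)) i j = 0.
  by rewrite tr_diag_mx scaleN1r mulX_diag subrr mxE.
apply: (dom_ext (expands_small X sm z)) => t.
by rewrite !(mul0mx, mulmx0, add0r, addr0, mul_mx_diag, mul_diag_mx) !mxE; ring.
Qed.

Lemma prod_sym_lin' i j : dm (fun t => P1 t j i * v 0 j - v 0 i * P1 t i j).
Proof.
have cv := expands_cst h delta (diag_mx v).
have X := expandsD (expandsM h_ge0 h_le1 h_sqr (expands_tr expands_P) cv)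
  (expandsZ (-1) (expandsM h_ge0 h_le1 h_sqr cv expands_P)).
have eL := expands_layer (ltn0Sn n.+1).
have sm : mdom delta (fun t => (P t)^T *m diag_mx v + -1 *: (diag_mx v *m P t)).
  have sg : mdom delta (fun t => (W t 0)^T *m g t 0).
    apply: (mdom_bd_small h_sqr); last exact: g_small.
    by apply: mdom_tr; case: eL.
  apply: (mdom_ext (mdomZ (-2^-1) (mdomB sg (mdom_tr sg)))) => t.
  have -> : (W t 0)^T *m g t 0 = 2 *: ((P t)^T *m E t + lam *: ((W t 0)^T *m W t 0)).
    rewrite gE // subn0 trmx1 mulmx1 -scalemxAr mulmxDr -scalemxAr; congr (_ *: (_ + _)).
    by rewrite mulmxA -trmx_mul -segwS.
  rewrite EE -[segw _ _ _]/(P t) mulmxBr antisym_part ?trmx_mul ?trmxK //.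
  by rewrite tr_diag_mx.
have z : ((diagX n.+2)^T *m diag_mx v + -1 *: (diag_mx v *m diagX n.+2)) i j = 0.
  by rewrite tr_diag_mx scaleN1r mulX_diag subrr mxE.
apply: (dom_ext (expands_small X sm z)) => t.
by rewrite !(mul0mx, mulmx0, add0r, addr0, mul_mx_diag, mul_diag_mx) !mxE; ring.
Qed.

(** The two symmetry relations form a linear system in [P1 t i j] and [P1 t j i] with determinant
    [v_j^2 - v_i^2], which is nonzero because both [v] are nonnegative and distinct. *)
Lemma prod_neq i j : v 0 i != v 0 j -> dm (fun t => P1 t i j).
Proof.
move=> ne.
have ne2 : v 0 i ^+ 2 - v 0 j ^+ 2 != 0.
  by rewrite subr_eq0 eqrXn2.
apply: (dom_lin2 (c1 := v 0 j / (v 0 i ^+ 2 - v 0 j ^+ 2))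
  (c2 := - v 0 i / (v 0 i ^+ 2 - v 0 j ^+ 2)) (prod_sym_lin i j)
  (prod_sym_lin' i j)) => t.
by field.
Qed.

(** The first variation of the gradient, by the Leibniz rule over the two transposed segments, the
    residual and the regularization. Transposition is why the segment variations appear at [j i];
    [crit] removes the zero-order part. *)
Lemma grad_lin l i j : (l < n.+2)%N -> dm (fun t =>
  lam * H t l i j + (α i ^+ n.+2 - v 0 i) * α i ^+ (n.+1 - l) * segw1 t 0 l j i
  + α i ^+ (n.+1 - l) * P1 t i j * α j ^+ l
  + (α j ^+ n.+2 - v 0 j) * α j ^+ l * segw1 t l.+1 (n.+1 - l) j i).
Proof.
move=> hl.
have eE : exps E (diagX n.+2 - diag_mx v) (fun t => P1 t + 0).
  have -> : E = fun t => P t + - diag_mx v by apply/funext => t; rewrite EE.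
  exact: expandsD expands_P (expands_cst _ _ _).
have eA := expands_tr (@expands_segw l.+1 (n.+1 - l) ltac:(lia)).
have eB := expands_tr (@expands_segw 0 l ltac:(lia)).
have X := expandsD (expandsM h_ge0 h_le1 h_sqr (expandsM h_ge0 h_le1 h_sqr eA eE) eB)
  (expandsZ lam (expands_layer hl)).
have sm : mdom delta (fun t => (segw (W t) l.+1 (n.+1 - l))^T *m E t *m (segw (W t) 0 l)^T
    + lam *: W t l).
  apply: (mdom_ext (mdomZ 2^-1 (g_small hl))) => t.
  by rewrite gE // scalerA mulVf ?scale1r.
have z : ((diagX (n.+1 - l))^T *m (diagX n.+2 - diag_mx v) *m (diagX l)^T + lam *: D) i j = 0.
  rewrite !tr_diag_mx mul_mx_diag mul_diag_mx !mxE.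
  case: eqP => [->|_]; rewrite ?mulr1n ?mulr0n; last by ring.
  rewrite -[RHS](crit j) -(subnK (hl : l <= n.+1)%N) exprD subnK //; ring.
apply: (dom_ext (expands_small X sm z)) => t.
have -> : diagX n.+2 - diag_mx v = diag_mx (\row_p (α p ^+ n.+2 - v 0 p)).
  by apply/matrixP => p q; rewrite !mxE -mulrnBl.
rewrite addr0 !tr_diag_mx !mulmxDl mulmx_diag.
rewrite !(mul_mx_diag, mul_diag_mx) !mxE.
ring.
Qed.

Lemma v_gt0 i : 0 < α i -> 0 < v 0 i.
Proof.
move=> ai; rewrite lt_def v_ge0 andbT; apply/eqP => v0; have := crit i.
rewrite v0 subr0 -exprD => /eqP; apply/negP; rewrite gt_eqF //.
by rewrite addr_gt0 ?mulr_gt0 ?exprn_gt0.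
Qed.

Lemma layer_ratio l i j : 0 < α i -> (l < n.+2)%N ->
  dm (fun t => H t l i j - (α j / α i) ^+ l * H t 0 i j).
Proof.
move=> ai hl; apply: (dom_lin1 (c := (α i ^+ l)^-1) (shift_iter i j hl)) => t.
by rewrite expr_div_n; field; rewrite expf_neq0 // gt_eqF.
Qed.

Lemma layer_ratio_rev l i j : 0 < α i -> (l < n.+2)%N ->
  dm (fun t => H t l j i - (α j / α i) ^+ (n.+1 - l) * H t n.+1 j i).
Proof.
move=> ai hl.
apply: (dom_lin1 (c := (α i ^+ (n.+1 - l))^-1) (shift_iter_rev j i hl)) => t.
by rewrite expr_div_n; field; rewrite expf_neq0 // gt_eqF.
Qed.

(** The factor between an end entry of [H] and the first variation of the end-to-end product when
    the layers follow the geometric law of [layer_ratio]. Reversing the sum shows that the same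
    factor serves the transposed entry, measured from the last layer. *)
Definition geoS i j :=
  \sum_(l < n.+2) α i ^+ (n.+1 - l) * (α j / α i) ^+ l * α j ^+ l.

Lemma geoS_gt0 i j : 0 < α i -> 0 < geoS i j.
Proof.
move=> ai; rewrite /geoS big_ord_recl ltr_pwDl //.
  by rewrite !mulr1 exprn_gt0.
by apply: sumr_ge0 => l _; rewrite !mulr_ge0 ?exprn_ge0 ?divr_ge0.
Qed.

Lemma prod_ratio i j : 0 < α i -> dm (fun t => P1 t i j - geoS i j * H t 0 i j).
Proof.
move=> ai; apply: (dom_ext (f := fun t => \sum_(l < n.+2)
  (α i ^+ (n.+1 - l) * α j ^+ l) * (H t l i j - (α j / α i) ^+ l * H t 0 i j))).
  by apply: dom_sum => l _; apply: (dom_lin1 (layer_ratio j ai (ltn_ord l))) => t.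
move=> t; rewrite mxE /geoS mulr_suml -sumrB; apply: eq_bigr => l _.
by rewrite add0n; ring.
Qed.

Lemma prod_ratio_rev i j : 0 < α i -> dm (fun t => P1 t j i - geoS i j * H t n.+1 j i).
Proof.
move=> ai; apply: (dom_ext (f := fun t => \sum_(l < n.+2)
  (α j ^+ (n.+1 - l) * α i ^+ l) * (H t l j i - (α j / α i) ^+ (n.+1 - l) * H t n.+1 j i))).
  by apply: dom_sum => l _; apply: (dom_lin1 (layer_ratio_rev j ai (ltn_ord l))) => t.
move=> t; rewrite mxE /geoS [X in _ - X * _](reindex_inj rev_ord_inj) /= mulr_suml -sumrB.
apply: eq_bigr => l _; rewrite add0n !subSS subKn; last by rewrite -ltnS.
by ring.
Qed.

Lemma small_of_ends i j : 0 < α i ->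
  dm (fun t => H t 0 i j) -> dm (fun t => H t n.+1 j i) ->
  forall l, (l < n.+2)%N -> dm (fun t => H t l i j) /\ dm (fun t => H t l j i).
Proof.
move=> ai h0 h1 l hl; split.
  apply: (dom_lin2 (c1 := 1) (c2 := (α j / α i) ^+ l) (layer_ratio j ai hl) h0) => t.
  by ring.
apply: (dom_lin2 (c1 := 1) (c2 := (α j / α i) ^+ (n.+1 - l)) (layer_ratio_rev j ai hl) h1) => t.
by ring.
Qed.

Lemma small_pos_neq i j : 0 < α i -> α i != α j ->
  forall l, (l < n.+2)%N -> dm (fun t => H t l i j) /\ dm (fun t => H t l j i).
Proof.
move=> ai ne; have S0 : geoS i j != 0 by rewrite gt_eqF ?geoS_gt0.
have ai0 : α i != 0 by rewrite gt_eqF.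
have [ve|vne] := eqVneq (v 0 i) (v 0 j); last first.
  apply: small_of_ends => //.
    apply: (dom_lin2 (c1 := (geoS i j)^-1) (c2 := - (geoS i j)^-1) (prod_neq vne)
      (prod_ratio j ai)) => t; by field.
  have vne' : v 0 j != v 0 i by rewrite eq_sym.
  apply: (dom_lin2 (c1 := (geoS i j)^-1) (c2 := - (geoS i j)^-1) (prod_neq vne')
      (prod_ratio_rev j ai)) => t; by field.
have vi := v_gt0 ai; have vi0 : v 0 i != 0 by rewrite gt_eqF.
(* For equal [v], symmetry of the product compares [P1 t i j] with [P1 t j i], and both are
   [geoS i j] times an end entry. *)
have hdiff : dm (fun t => H t 0 i j - H t n.+1 j i).
  have hP := prod_sym_lin i j.
  apply: (dom_lin3 (c1 := - (v 0 i * geoS i j)^-1) (c2 := - (geoS i j)^-1)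
    (c3 := (geoS i j)^-1) hP (prod_ratio j ai) (prod_ratio_rev j ai)) => t.
  by rewrite -ve; field; rewrite S0.
set q := α j / α i.
(* Rewriting [H t 0 j i] and [H t n.+1 i j] by the ratio law turns [orth_end] into this number times
   [H t 0 i j + H t n.+1 j i]; it equals [α i * (1 - q ^+ n.+2)] with [q] different from 1. *)
have q1 : α i - α j * q ^+ n.+1 != 0.
  have -> : α i - α j * q ^+ n.+1 = α i * (1 - q ^+ n.+2).
    by rewrite mulrBr mulr1 (exprS q n.+1) mulrA [α i * q]mulrC divfK.
  rewrite mulf_neq0 // subr_eq0 eq_sym pexpr_eq1 // ?divr_ge0 //.
  by apply: contra ne => /eqP q1; rewrite -[α j](divfK ai0) -/q q1 mul1r.
have hsum : dm (fun t => H t 0 i j + H t n.+1 j i).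
  apply: (dom_lin3 (c1 := (α i - α j * q ^+ n.+1)^-1)
     (c2 := α j * (α i - α j * q ^+ n.+1)^-1) (c3 := α j * (α i - α j * q ^+ n.+1)^-1)
     (orth_end vi ve) (layer_ratio j ai (ltnSn n.+1)) (layer_ratio_rev j ai (ltn0Sn n.+1))) => t.
  by rewrite -/q subn0; field.
by apply: small_of_ends => //;
  [apply: (dom_lin2 (c1 := 2^-1) (c2 := 2^-1) hsum hdiff)
  |apply: (dom_lin2 (c1 := 2^-1) (c2 := - 2^-1) hsum hdiff)] => t; lra.
Qed.

(** Modulo [delta] all layers share one entry, which is symmetric in [i] and [j], so the gradient at
    layer 0 becomes a scalar multiple of it. The multiplier collects [lam], the term
    [n.+2 * α^(2 n.+1)] from the residual and [- n.+1 * lam] from the variation of the other layers: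
    it is the number that [nondeg_pos] keeps away from zero. The diagonal case [i = j] is
    included. *)
Lemma small_pos_eq i j : 0 < α i -> α i = α j ->
  forall l, (l < n.+2)%N -> dm (fun t => H t l i j).
Proof.
move=> ai e; have aj : 0 < α j by rewrite -e.
have ai0 : α i != 0 by rewrite gt_eqF.
have vi := v_gt0 ai; have vi0 : v 0 i != 0 by rewrite gt_eqF.
have q1 : α j / α i = 1 by rewrite -e divff.
have q1' : α i / α j = 1 by rewrite e divff // -e.
have ve : v 0 i = v 0 j.
  have := crit i; have := crit j; rewrite -e => <- /addIr /(mulfI (expf_neq0 _ ai0)) hv.
  by apply: oppr_inj; apply: (addrI (α i ^+ n.+2)).
have x_cst l : (l < n.+2)%N -> dm (fun t => H t l i j - H t 0 i j).
  move=> hl; apply: (dom_ext (layer_ratio j ai hl)) => t.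
  by rewrite q1 expr1n mul1r.
have z_cst l : (l < n.+2)%N -> dm (fun t => H t l j i - H t 0 j i).
  move=> hl; apply: (dom_ext (layer_ratio i aj hl)) => t.
  by rewrite q1' expr1n mul1r.
have Sij : geoS j i = geoS i j by rewrite /geoS e.
have S0 : geoS i j != 0 by rewrite gt_eqF ?geoS_gt0.
have xz : dm (fun t => H t 0 i j - H t 0 j i).
  apply: (dom_lin3 (c1 := - (v 0 i * geoS i j)^-1) (c2 := - (geoS i j)^-1)
    (c3 := (geoS i j)^-1) (prod_sym_lin i j) (prod_ratio j ai) (prod_ratio i aj)) => t.
  by rewrite -ve Sij; field; rewrite S0.
have crit' : (α i ^+ n.+2 - v 0 i) * α i ^+ n = - lam.
  apply: (mulfI ai0); rewrite mulrCA -exprS; have := crit i; lra.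
have z_sum : dm (fun t => segw1 t 1 n.+1 j i - n.+1%:R * α i ^+ n * H t 0 i j).
  apply: (dom_ext (f := fun t => \sum_(l < n.+1) α i ^+ n * (H t l.+1 j i - H t 0 i j))).
    apply: dom_sum => l _.
    by apply: (dom_lin2 (c1 := α i ^+ n) (c2 := - α i ^+ n)
       (z_cst l.+1 (ltn_ord l : (l.+1 < n.+2)%N)) xz) => t; ring.
  move=> t; rewrite mxE -mulr_sumr sumrB sumr_const card_ord -mulr_natl mulrBr.
  rewrite [in RHS]mulr_sumr; congr (_ - _); last by ring.
  apply: eq_bigr => l _; rewrite add1n -e mulrAC -exprD subnK //.
  by rewrite -ltnS.
have x_sum : dm (fun t => P1 t i j - n.+2%:R * α i ^+ n.+1 * H t 0 i j).
  apply: (dom_ext (prod_ratio j ai)) => t; congr (_ - _ * _).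
  rewrite /geoS q1 -e -[n.+2%:R]/(n.+2%:R : R) mulr_natl -[in LHS](card_ord n.+2) -sumr_const.
  apply: eq_bigr => l _; rewrite expr1n mulr1 -exprD subnK //.
  by rewrite -ltnS.
have := nondeg_pos ai; rewrite -subr_eq0 => nd.
set κ := (_ - _) in nd.
have x0 : dm (fun t => H t 0 i j).
  apply: (dom_lin3 (c1 := κ^-1) (c2 := - κ^-1 * α i ^+ n.+1)
     (c3 := - κ^-1 * (α i ^+ n.+2 - v 0 i))
     (@grad_lin 0 i j (ltn0Sn _)) x_sum z_sum) => t.
  rewrite subn0 [segw1 t 0 0 j i]mxE big_ord0 -e -ve expr0.
  rewrite -[LHS](mulKf nd).
  have -> : κ * H t 0 i j = lam * H t 0 i j + α i ^+ n.+1 * (n.+2%:R * α i ^+ n.+1 * H t 0 i j)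
      + n.+1%:R * ((α i ^+ n.+2 - v 0 i) * α i ^+ n) * H t 0 i j.
    by rewrite crit' /κ mul2n -addnn exprD; ring.
  by ring.
by move=> l hl; apply: (dom_lin2 (c1 := 1) (c2 := 1) (x_cst l hl) x0) => t; ring.
Qed.

(** With at least two other layers, the first variation of their product still contains a zero
    factor, so the linearized gradient is just [lam * H]. With a single other layer, [H t 0 p q] and
    [H t 1 q p] are coupled by a system of determinant [lam ^+ 2 - v_q ^+ 2]. *)
Lemma small_zero i j : α i = 0 -> α j = 0 ->
  forall l, (l < n.+2)%N -> dm (fun t => H t l i j).
Proof.
move=> ai aj.
have seg0 t m k p q : α p = 0 -> α q = 0 -> (1 < k)%N -> segw1 t m k p q = 0.
  move=> hp hq hk; rewrite mxE big1 // => s _; rewrite hp hq !expr0n.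
  case: (posnP s) => [->|s0]; last by rewrite mulr0.
  by rewrite subn0 gtn_eqF ?mul0r //; case: k hk {s} => [|[]].
case: (posnP n) => [n0|n_gt0] l hl; last first.
  apply: (dom_lin1 (c := lam^-1) (grad_lin i j hl)) => t.
  rewrite ai aj !expr0n /=.
  have [l0|l_gt0] := posnP l.
    by rewrite l0 subn0 !mul0r (seg0 _ _ n.+1) // !mulr0 !mul0r !addr0 mulKf ?gt_eqF.
  rewrite !mulr0 !mul0r !addr0.
  have [ll|ll] := eqVneq l n.+1; last first.
    have -> : (n.+1 - l == 0)%N = false by apply/negbTE; lia.
    by rewrite !mulr0 !mul0r addr0 mulKf ?gt_eqF.
  by rewrite ll seg0 // mulr0 addr0 mulKf ?gt_eqF.
have key p q : α p = 0 -> α q = 0 -> dm (fun t => H t 0 p q) /\ dm (fun t => H t 1%N q p).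
  move=> hp hq.
  have A : dm (fun t => lam * H t 0 p q - v 0 q * H t 1%N q p).
    apply: (dom_ext (@grad_lin 0 p q (ltn0Sn _))) => t.
    rewrite hp hq n0 !subn0 !expr0n /= !mulr0 !mul0r !addr0 mxE big_ord1 /= addn0.
    by rewrite hp hq !expr0; ring.
  have B : dm (fun t => lam * H t 1%N q p - v 0 q * H t 0 p q).
    apply: (dom_ext (@grad_lin 1 q p ltac:(by rewrite n0))) => t.
    rewrite hp hq n0 subnn !expr0n /= !mulr0 !mul0r !addr0 mxE big_ord1 /=.
    by rewrite hp hq !expr0; ring.
  have nd : lam ^+ 2 - v 0 q ^+ 2 != 0 by rewrite subr_eq0 nondeg_zero.
  split; [apply: (dom_lin2 (c1 := lam / (lam ^+ 2 - v 0 q ^+ 2))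
    (c2 := v 0 q / (lam ^+ 2 - v 0 q ^+ 2)) A B)
  |apply: (dom_lin2 (c1 := v 0 q / (lam ^+ 2 - v 0 q ^+ 2))
    (c2 := lam / (lam ^+ 2 - v 0 q ^+ 2)) A B)] => t; by field.
have [->|l_gt0] := posnP l; first by case: (key i j).
have -> : l = 1%N by move: hl; rewrite n0; lia.
by case: (key j i).
Qed.

Lemma deviation_small l i j : (l < n.+2)%N -> dm (fun t => H t l i j).
Proof.
move=> hl; have [ai|ai] := ltrP 0 (α i).
  have [e|ne] := eqVneq (α i) (α j); first exact: small_pos_eq.
  by case: (small_pos_neq ai ne hl).
have {}ai : α i = 0 by apply/le_anti; rewrite ai a_ge0.
have [aj|aj] := ltrP 0 (α j).
  have ne : α j != α i by rewrite ai gt_eqF.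
  by case: (small_pos_neq aj ne hl).
by apply: small_zero => //; apply/le_anti; rewrite aj a_ge0.
Qed.

End Core.

(** * Derivatives along a line, entry by entry *)

Section Derivatives.
Context (R : realType).

Local Notation dR := (is_derive (0 : R) (1 : R)).

Lemma derivD (f g : R -> R) a b : dR f a -> dR g b -> dR (fun t => f t + g t) (a + b).
Proof. exact: is_deriveD. Qed.

Lemma derivM (f g : R -> R) a b : dR f a -> dR g b ->
  dR (fun t => f t * g t) (f 0 * b + g 0 * a).
Proof. exact: is_deriveM. Qed.

Lemma deriv_sum m (f : 'I_m -> R -> R) a : (forall i, dR (f i) (a i)) ->
  dR (fun t => \sum_i f i t) (\sum_i a i).
Proof.
move=> hf; have := is_derive_sum hf.
by have -> : \sum_i f i = fun t => \sum_i f i t by apply/funext => t; rewrite fct_sumE.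
Qed.

Lemma deriv_affine (a b : R) : dR (fun t => a + t * b) b.
Proof.
have h : dR (fun t => t * b) (0 * 0 + b * 1).
  exact: derivM (is_derive_id _ _) (is_derive_cst _ _ _).
apply: (is_derive_eq (derivD (is_derive_cst a _ _) h)).
by rewrite mul0r add0r mulr1 add0r.
Qed.

Lemma deriv_mulmx p q r (A : R -> 'M[R]_(p, q)) (B : R -> 'M[R]_(q, r))
    (A' : 'M[R]_(p, q)) (B' : 'M[R]_(q, r)) :
  (forall i j, dR (fun t => A t i j) (A' i j)) ->
  (forall i j, dR (fun t => B t i j) (B' i j)) ->
  forall i j, dR (fun t => (A t *m B t) i j) ((A' *m B 0 + A 0 *m B') i j).
Proof.
move=> hA hB i j.
have -> : (fun t => (A t *m B t) i j) = fun t => \sum_k A t i k * B t k j.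
  by apply/funext => t; rewrite mxE.
apply: (is_derive_eq (deriv_sum (fun k => derivM (hA i k) (hB k j)))).
by rewrite !mxE -big_split; apply: eq_bigr => k _; rewrite addrC mulrC.
Qed.

Lemma deriv_frob2 p q (A : R -> 'M[R]_(p, q)) (A' : 'M[R]_(p, q)) :
  (forall i j, dR (fun t => A t i j) (A' i j)) ->
  dR (fun t => frob2 (A t)) (2 * frobdot (A 0) A').
Proof.
move=> hA; rewrite /frob2.
apply: (is_derive_eq (deriv_sum (fun i => deriv_sum (fun j => derivM (hA i j) (hA i j))))).
rewrite /frobdot mulr_sumr; apply: eq_bigr => i _; rewrite mulr_sumr.
by apply: eq_bigr => j _; rewrite -mulr2n mulr_natl.
Qed.

End Derivatives.

(** * The Frobenius inner product *)

Section FrobeniusProduct.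
Context (R : realType).

Lemma frobdotE p q (A B : 'M[R]_(p, q)) : frobdot A B = \tr (A^T *m B).
Proof.
rewrite /frobdot exchange_big; apply: eq_bigr => j _; rewrite mxE.
by apply: eq_bigr => i _; rewrite mxE.
Qed.

Lemma frob2E p q (A : 'M[R]_(p, q)) : frob2 A = frobdot A A.
Proof. by apply: eq_bigr => i _; apply: eq_bigr => j _. Qed.

Lemma frobdotC p q (A B : 'M[R]_(p, q)) : frobdot A B = frobdot B A.
Proof. by apply: eq_bigr => i _; apply: eq_bigr => j _; rewrite mulrC. Qed.

Lemma frobdotDr p q (A B C : 'M[R]_(p, q)) : frobdot A (B + C) = frobdot A B + frobdot A C.
Proof. by rewrite !frobdotE mulmxDr linearD. Qed.

Lemma frobdotZr p q (A B : 'M[R]_(p, q)) c : frobdot A (c *: B) = c * frobdot A B.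
Proof. by rewrite !frobdotE -scalemxAr linearZ. Qed.

Lemma frobdotDl p q (A B C : 'M[R]_(p, q)) : frobdot (A + B) C = frobdot A C + frobdot B C.
Proof. by rewrite !(frobdotC _ C) frobdotDr. Qed.

Lemma frobdotZl p q (A B : 'M[R]_(p, q)) c : frobdot (c *: A) B = c * frobdot A B.
Proof. by rewrite !(frobdotC _ B) frobdotZr. Qed.

Lemma frobdotBr p q (A B C : 'M[R]_(p, q)) : frobdot A (B - C) = frobdot A B - frobdot A C.
Proof. by rewrite -scaleN1r frobdotDr frobdotZr mulN1r. Qed.

Lemma frobdot_sumr p q (A : 'M[R]_(p, q)) m (F : 'I_m -> 'M[R]_(p, q)) :
  frobdot A (\sum_i F i) = \sum_i frobdot A (F i).
Proof. by rewrite frobdotE mulmx_sumr linear_sum; apply: eq_bigr => i _; rewrite frobdotE. Qed.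

Lemma frobdot_adj p q r s (A : 'M[R]_(p, q)) (B : 'M[R]_(p, r)) (C : 'M[R]_(r, s))
    (F : 'M[R]_(s, q)) :
  frobdot A (B *m C *m F) = frobdot (B^T *m A *m F^T) C.
Proof.
rewrite !frobdotE !trmx_mul !trmxK !mulmxA mxtrace_mulC.
by rewrite -!mulmxA.
Qed.

Lemma frob2_ge0 p q (A : 'M[R]_(p, q)) : 0 <= frob2 A.
Proof. by apply: sumr_ge0 => i _; apply: sumr_ge0 => j _; apply: sqr_ge0. Qed.

Lemma frob2_eq0 p q (A : 'M[R]_(p, q)) : frob2 A = 0 -> A = 0.
Proof.
move=> /eqP; rewrite psumr_eq0 => [/allP h|i _]; last first.
  by apply: sumr_ge0 => j _; apply: sqr_ge0.
apply/matrixP => i j; rewrite mxE.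
have := h i (mem_index_enum _); rewrite psumr_eq0 => [/allP /(_ j (mem_index_enum _))|k _].
  by rewrite sqrf_eq0 => /eqP.
exact: sqr_ge0.
Qed.

Lemma frob2_entry p q (A : 'M[R]_(p, q)) i j : A i j ^+ 2 <= frob2 A.
Proof.
rewrite /frob2 (bigD1 i) //= (bigD1 j) //= -addrA lerDl addr_ge0 //.
  by apply: sumr_ge0 => k _; apply: sqr_ge0.
by apply: sumr_ge0 => k _; apply: sumr_ge0 => l _; apply: sqr_ge0.
Qed.

Lemma frob2_ortho p q (A : 'M[R]_(p, q)) (P : 'M[R]_p) (Q : 'M[R]_q) :
  Defs.orthomx P -> Defs.orthomx Q -> frob2 (P^T *m A *m Q) = frob2 A.
Proof.
move=> hP hQ; rewrite !frob2E frobdot_adj trmxK !mulmxA hP mul1mx.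
by rewrite -mulmxA hQ mulmx1.
Qed.

End FrobeniusProduct.

(** * Embedding rectangular matrices in one square matrix ring *)

Section Padding.
Context (R : realType) (N : nat).

(* Embedding all layers in a common [N x N] matrix ring makes the partial products
   [W_{L-1} ... W_l] expressible without casts between dimensions. *)
Definition padm p q (M : 'M[R]_(p, q)) : 'M[R]_N := pid_mx p *m M *m pid_mx q.
Definition unpad p q (M : 'M[R]_N) : 'M[R]_(p, q) := pid_mx p *m M *m pid_mx q.
(** Completed by the identity instead of zero, so that orthogonality survives the embedding. *)
Definition padI p (U : 'M[R]_p) : 'M[R]_N := 1%:M - pid_mx p + padm U.

Lemma pid_retract p : (p <= N)%N ->
  (pid_mx p : 'M[R]_(p, N)) *m (pid_mx p : 'M[R]_(N, p)) = 1%:M.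
Proof. by move=> h; rewrite mul_pid_mx minnn (minn_idPr h) pid_mx_1. Qed.

Lemma pid_proj p : (pid_mx p : 'M[R]_(N, p)) *m (pid_mx p : 'M[R]_(p, N)) = pid_mx p.
Proof. by rewrite mul_pid_mx !minnn. Qed.

Lemma padM p q r (A : 'M[R]_(p, q)) (B : 'M[R]_(q, r)) : (q <= N)%N ->
  padm (A *m B) = padm A *m padm B.
Proof.
move=> h; rewrite /padm -!mulmxA (mulmxA (pid_mx q : 'M[R]_(q, N))).
by rewrite pid_retract // mul1mx.
Qed.

Lemma padD p q (A B : 'M[R]_(p, q)) : padm (A + B) = padm A + padm B.
Proof. by rewrite /padm mulmxDr mulmxDl. Qed.

Lemma padZ p q c (A : 'M[R]_(p, q)) : padm (c *: A) = c *: padm A.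
Proof. by rewrite /padm -scalemxAr -scalemxAl. Qed.

Lemma padB p q (A B : 'M[R]_(p, q)) : padm (A - B) = padm A - padm B.
Proof. by rewrite -scaleN1r padD padZ scaleN1r. Qed.

Lemma pad_tr p q (A : 'M[R]_(p, q)) : padm A^T = (padm A)^T.
Proof. by rewrite /padm !trmx_mul !tr_pid_mx mulmxA. Qed.

Lemma padK p q (A : 'M[R]_(p, q)) : (p <= N)%N -> (q <= N)%N -> unpad p q (padm A) = A.
Proof.
move=> hp hq; rewrite /unpad /padm !mulmxA pid_retract // mul1mx.
by rewrite -mulmxA pid_retract // mulmx1.
Qed.

Lemma pad_projl p q (A : 'M[R]_(p, q)) : (p <= N)%N -> pid_mx p *m padm A = padm A.
Proof. 
move=> h; rewrite /padm !mulmxA -[X in X *m _ *m _ *m _]pid_proj -!mulmxA.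
by rewrite (mulmxA (pid_mx p : 'M[R]_(p, N))) pid_retract // mul1mx.
Qed.

Lemma pad_projr p q (A : 'M[R]_(p, q)) : (q <= N)%N -> padm A *m pid_mx q = padm A.
Proof. by move=> h; apply: trmx_inj; rewrite trmx_mul tr_pid_mx -pad_tr pad_projl. Qed.

Lemma frobdot_padl p q (A : 'M[R]_(p, q)) (X : 'M[R]_N) :
  frobdot (padm A) X = frobdot A (unpad p q X).
Proof. by rewrite /unpad frobdot_adj !tr_pid_mx. Qed.

Lemma frobdot_pad p q (A B : 'M[R]_(p, q)) : (p <= N)%N -> (q <= N)%N ->
  frobdot (padm A) (padm B) = frobdot A B.
Proof. by move=> hp hq; rewrite frobdot_padl padK. Qed.

Lemma frob2_pad p q (A : 'M[R]_(p, q)) : (p <= N)%N -> (q <= N)%N ->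
  frob2 (padm A) = frob2 A.
Proof. by move=> hp hq; rewrite !frob2E frobdot_pad. Qed.

Lemma padI_padm p q (U : 'M[R]_p) (A : 'M[R]_(p, q)) : (p <= N)%N ->
  padI U *m padm A = padm (U *m A).
Proof. by move=> h; rewrite /padI !mulmxDl mulNmx mul1mx pad_projl // subrr add0r -padM. Qed.

Lemma padI_tr p (U : 'M[R]_p) : padI U^T = (padI U)^T.
Proof. by rewrite /padI pad_tr !linearD linearN /= trmx1 tr_pid_mx. Qed.

Lemma padm_padI p q (U : 'M[R]_q) (A : 'M[R]_(p, q)) : (q <= N)%N ->
  padm A *m padI U = padm (A *m U).
Proof.
move=> h; apply: trmx_inj.
by rewrite trmx_mul -padI_tr -!pad_tr padI_padm // trmx_mul.
Qed.

Lemma padm1 p : padm (1%:M : 'M[R]_p) = pid_mx p.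
Proof. by rewrite /padm mulmx1 pid_proj. Qed.

Lemma padI_ortho p (U : 'M[R]_p) : (p <= N)%N -> Defs.orthomx U -> Defs.orthomx (padI U).
Proof.
move=> h hU; rewrite /Defs.orthomx {1}/padI mulmxDl -padI_tr padm_padI // hU padm1.
rewrite mulmxBl mul1mx /padI mulmxDr mulmxBr mulmx1 -!padm1 -!padM // !mul1mx.
by rewrite subrr add0r addrK subrK.
Qed.

Lemma pad_entry p q (A : 'M[R]_(p, q)) (i : 'I_p) (j : 'I_q) (i' j' : 'I_N) :
  i = i' :> nat -> j = j' :> nat -> padm A i' j' = A i j.
Proof.
move=> ei ej; rewrite /padm mxE (bigD1 j) //= mxE (bigD1 i) //= !mxE ei ej !eqxx.
rewrite -ei -ej !ltn_ord /= mulr1 mul1r !big1 ?addr0 //.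
  move=> k nk; rewrite [pid_mx q k j']mxE -ej.
  by rewrite (val_eqE k j) (negPf nk) mulr0.
move=> k nk; rewrite mxE -ei.
by rewrite (val_eqE i k) eq_sym (negPf nk) mul0r.
Qed.

Lemma pad_entry_row p q (A : 'M[R]_(p, q)) (i j : 'I_N) : (p <= i)%N -> padm A i j = 0.
Proof.
move=> h; rewrite /padm -mulmxA mxE big1 // => k _; rewrite mxE.
by case: eqP => [e|]; rewrite ?mul0r //; have := ltn_ord k; rewrite -e ltnNge h.
Qed.

Lemma pad_entry_col p q (A : 'M[R]_(p, q)) (i j : 'I_N) : (q <= j)%N -> padm A i j = 0.
Proof. by move=> h; rewrite -[A]trmxK pad_tr mxE pad_entry_row. Qed.

End Padding.

(** * The gradient of the objective in padded form *)

Section Gradient.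
Context (R : realType).

(** The derivative of [segw w 0 k] in direction [v], in the recursive form delivered by the product
    rule; [dprodE] is its closed form. *)
Fixpoint dprod N (w v : nat -> 'M[R]_N) k : 'M[R]_N :=
  if k is k'.+1 then v k' *m segw w 0 k' + w k' *m dprod w v k' else 0.

Lemma dprodE N (w v : nat -> 'M[R]_N) k :
  dprod w v k = \sum_(l < k) segw w l.+1 (k - l.+1) *m v l *m segw w 0 l.
Proof.
elim: k => [|k IH]; first by rewrite big_ord0.
rewrite big_ord_recr /= subnn mul1mx addrC IH mulmx_sumr; congr (_ + _).
apply: eq_bigr => l _; have hl := ltn_ord l.
have -> : (k.+1 - l.+1 = (k - l.+1).+1)%N by lia.
by rewrite /= subnKC // !mulmxA.
Qed.

Lemma deriv_segw N (w v : nat -> 'M[R]_N) k i j :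
  is_derive (0 : R) (1 : R) (fun t => segw (fun l => w l + t *: v l) 0 k i j)
    (dprod w v k i j).
Proof.
elim: k i j => [|k IH] i j /=.
  by rewrite [X in is_derive _ _ _ X]mxE; exact: is_derive_cst.
have hA p q : is_derive (0 : R) (1 : R) (fun t => (w k + t *: v k) p q) (v k p q).
  rewrite (_ : (fun t => _) = fun t => w k p q + t * v k p q); first exact: deriv_affine.
  by apply/funext => t; rewrite !mxE.
apply: (is_derive_eq (deriv_mulmx hA IH i j)); rewrite scale0r addr0.
congr ((_ *m _ + _) i j); apply: eq_segw => l _.
by rewrite scale0r addr0.
Qed.

Context (d : nat -> nat) (N : nat).

Lemma pad_prodW (W : wtuple R d) k : (forall l, (l <= k)%N -> d l <= N)%N ->
  padm N (prodW W k) = segw (fun l => padm N (W l)) 0 k *m pid_mx (d 0).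
Proof.
elim: k => [|k IH] hN /=; first by rewrite padm1 mul1mx.
by rewrite padM ?hN // IH ?mulmxA // => l hl; apply: hN; lia.
Qed.

Lemma pad_prodWS (W : wtuple R d) k : (forall l, (l <= k.+1)%N -> d l <= N)%N ->
  padm N (prodW W k.+1) = segw (fun l => padm N (W l)) 0 k.+1.
Proof.
by move=> hN; rewrite pad_prodW // segwS -mulmxA pad_projr // hN.
Qed.

Context (n : nat) (lam : R) (y : nat -> R).
Hypothesis hN : forall l, (l <= n.+2)%N -> (d l <= N)%N.

Definition padres (w : nat -> 'M[R]_N) : 'M[R]_N :=
  segw w 0 n.+2 - Num.sqrt lam *: padm N (diagY (d n.+2) (d 0) y).

Definition padgrad (w : nat -> 'M[R]_N) l : 'M[R]_N :=
  2 *: ((segw w l.+1 (n.+1 - l))^T *m padres w *m (segw w 0 l)^T + lam *: w l).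

Lemma Gobj_pad (W : wtuple R d) (w := fun l => padm N (W l)) :
  Gobj d n lam y W = frob2 (padres w) + lam * \sum_(l < n.+2) frob2 (w l).
Proof.
rewrite /Gobj /padres -pad_prodWS // -padZ -padB frob2_pad ?hN //.
congr (_ + _ * _); apply: eq_bigr => l _.
by rewrite frob2_pad // hN // ltnW.
Qed.

Lemma deriv_Gobj (W V : wtuple R d) (w := fun l => padm N (W l)) :
  is_derive (0 : R) (1 : R) (fun t : R => Gobj d n lam y (fun l => W l + t *: V l))
    (\sum_(l < n.+2) frobdot (padgrad w l) (padm N (V l))).
Proof.
pose v l := padm N (V l).
have e0 : (fun l => w l + 0 *: v l) = w.
  by apply/funext => l; rewrite scale0r addr0.
have -> : (fun t : R => Gobj d n lam y (fun l => W l + t *: V l)) =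
  fun t => frob2 (padres (fun l => w l + t *: v l))
    + lam * \sum_(l < n.+2) frob2 (w l + t *: v l).
  apply/funext => t; rewrite Gobj_pad.
  have -> : (fun l => padm N (W l + t *: V l)) = fun l => w l + t *: v l.
    by apply/funext => l; rewrite padD padZ.
  by congr (_ + _ * _); apply: eq_bigr => l _; rewrite padD padZ.
have h1 i j : is_derive (0 : R) (1 : R) (fun t => padres (fun l => w l + t *: v l) i j)
    (dprod w v n.+2 i j).
  rewrite (_ : (fun t => _) = fun t => segw (fun l => w l + t *: v l) 0 n.+2 i j +
      - (Num.sqrt lam *: padm N (diagY (d n.+2) (d 0) y)) i j).
    apply: (is_derive_eq (derivD (deriv_segw w v n.+2 i j) (is_derive_cst _ _ _))).
    by rewrite addr0.
  by apply/funext => t; rewrite [LHS]mxE [X in _ + X = _]mxE.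
have h2 (l : 'I_n.+2) : is_derive (0 : R) (1 : R) (fun t => frob2 (w l + t *: v l))
    (2 * frobdot (w l) (v l)).
  have h i j : is_derive (0 : R) (1 : R) (fun t => (w l + t *: v l) i j) (v l i j).
    rewrite (_ : (fun t => _) = fun t => w l i j + t * v l i j); first exact: deriv_affine.
    by apply/funext => t; rewrite !mxE.
  by apply: (is_derive_eq (deriv_frob2 h)); rewrite scale0r addr0.
apply: (is_derive_eq (derivD (deriv_frob2 h1)
  (derivM (is_derive_cst lam _ _) (deriv_sum h2)))).
rewrite mulr0 addr0 e0 dprodE frobdot_sumr !mulr_sumr -big_split; apply: eq_bigr => l _.
apply: esym; apply: (etrans (frobdotZl _ _ _)); rewrite frobdotDl.
rewrite frobdotZl -frobdot_adj mulrDr mulrCA.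
by rewrite subSS.
Qed.

(** Each term of the gradient begins and ends with a padded layer or with the padded residual, so it
    is zero outside its block and [unpad] loses nothing. *)
Lemma padgrad_supp (W : wtuple R d) (w := fun l => padm N (W l)) l : (l < n.+2)%N ->
  pid_mx (d l.+1) *m padgrad w l *m pid_mx (d l) = padgrad w l.
Proof.
move=> hl; have hl1 := hN hl; have hl0 := hN (ltnW hl).
have hE : padres w = padm N (prodW W n.+2 - Num.sqrt lam *: diagY (d n.+2) (d 0) y).
  by rewrite padB padZ pad_prodWS.
rewrite /padgrad -scalemxAr -scalemxAl mulmxDr mulmxDl -scalemxAr -scalemxAl.
rewrite pad_projl // pad_projr //; congr (_ *: (_ + _)).
have -> : pid_mx (d l.+1) *m ((segw w l.+1 (n.+1 - l))^T *m padres w *m (segw w 0 l)^T) =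
    (segw w l.+1 (n.+1 - l))^T *m padres w *m (segw w 0 l)^T.
  rewrite !mulmxA; congr (_ *m _).
  case e : (n.+1 - l)%N => [|k].
    have -> : l = n.+1 by lia.
    by rewrite trmx1 mulmx1 mul1mx hE pad_projl // hN.
  by rewrite segwS trmx_mul !mulmxA -pad_tr pad_projl // hN //; lia.
rewrite -!mulmxA; congr (_ *m _).
case: l hl hl1 hl0 => [|l] hl hl1 hl0.
  by rewrite trmx1 mul1mx mulmx1 hE pad_projr.
by rewrite [segw _ _ _]/= trmx_mul -mulmxA -pad_tr pad_projr.
Qed.

Lemma grad_pad (W Gr : wtuple R d) l : is_grad n.+2 (Gobj d n lam y) W Gr ->
  (l < n.+2)%N -> padm N (Gr l) = padgrad (fun l => padm N (W l)) l.
Proof.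
move=> hGr hl; set w := fun l => padm N (W l).
pose F (k : nat) : 'M[R]_(d k.+1, d k) := unpad (d k.+1) (d k) (padgrad w k).
(* Both gradients represent the same directional derivative; testing their difference against itself
   forces it to vanish. *)
pose V k := Gr k - F k.
have eq_d : tdot n.+2 Gr V = \sum_(k < n.+2) frobdot (padgrad w k) (padm N (V k)).
  by rewrite -(@derive_val _ _ _ _ _ _ _ (hGr V)) (@derive_val _ _ _ _ _ _ _ (deriv_Gobj W V)).
have z : \sum_(k < n.+2) frob2 (V k) = 0.
  have -> : \sum_(k < n.+2) frob2 (V k) =
      tdot n.+2 Gr V - \sum_(k < n.+2) frobdot (padgrad w k) (padm N (V k)).
    rewrite /tdot -sumrB; apply: eq_bigr => k _.
    by rewrite [X in _ - X]frobdotC frobdot_padl frob2E (frobdotC (Gr k)) -frobdotBr.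
  by rewrite eq_d subrr.
have /eqP := z; rewrite psumr_eq0 => [/allP h|k _]; last exact: frob2_ge0.
have /eqP := h (Ordinal hl) (mem_index_enum _).
move=> /frob2_eq0 /eqP; rewrite /V subr_eq0 /= => /eqP ->.
rewrite -[RHS]padgrad_supp // /padm /F /unpad !mulmxA pid_proj.
by rewrite -!mulmxA pid_proj.
Qed.

End Gradient.

(** * Equivariance of the gradient under the symmetries *)

Section Conjugation.
Context (R : realType) (d : nat -> nat) (N n : nat) (lam : R) (y : nat -> R).
Hypothesis hN : forall l, (l <= n.+2)%N -> (d l <= N)%N.

Lemma ortho_trl p (U : 'M[R]_p) : Defs.orthomx U -> U^T *m U = 1%:M.
Proof. exact: mulmx1C. Qed.

Lemma segw_conj (u w : nat -> 'M[R]_N) m k :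
  (forall l, (m <= l <= m + k)%N -> Defs.orthomx (u l)) ->
  segw (fun l => (u l.+1)^T *m w l *m u l) m k = (u (m + k)%N)^T *m segw w m k *m u m.
Proof.
elim: k => [|k IH] hu.
  by rewrite /= addn0 mulmx1 ortho_trl //; apply: hu; lia.
rewrite /= IH => [|l hl]; last by apply: hu; lia.
have uk : u (m + k)%N *m (u (m + k)%N)^T = 1%:M by apply: hu; lia.
by rewrite addnS -!mulmxA (mulmxA (u (m + k)%N)) uk mul1mx.
Qed.

Lemma mulmx_affine p q r s c (P : 'M[R]_(p, q)) (X Z : 'M[R]_(q, r)) (Q : 'M[R]_(r, s)) :
  P *m (X + c *: Z) *m Q = P *m X *m Q + c *: (P *m Z *m Q).
Proof. by rewrite mulmxDr mulmxDl -scalemxAr -scalemxAl. Qed.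

Context (U : forall l, 'M[R]_(d l)).
Hypotheses (hU : forall l, (l <= n.+2)%N -> Defs.orthomx (U l))
  (hY : U n.+2 *m diagY (d n.+2) (d 0) y = diagY (d n.+2) (d 0) y *m U 0).

Let u l := padI N (U l).

Lemma pad_conj (l : nat) (M : 'M[R]_(d l.+1, d l)) : (l < n.+2)%N ->
  padm N ((U l.+1)^T *m M *m U l) = (u l.+1)^T *m padm N M *m u l.
Proof.
move=> hl; rewrite /u -padI_tr padI_padm; last exact: hN.
by rewrite padm_padI //; apply: hN; exact: ltnW.
Qed.

(** Orthogonal factors cancel between consecutive layers, and [hY] makes the target transform like
    the end-to-end product. Hence the estimate can be made at the diagonal point. *)
Lemma padgrad_conj (W : wtuple R d) l : (l < n.+2)%N ->
  padgrad d n lam y (fun l => padm N ((U l.+1)^T *m W l *m U l)) l =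
  (u l.+1)^T *m padgrad d n lam y (fun l => padm N (W l)) l *m u l.
Proof.
move=> hl; have hu k : (k <= n.+2)%N -> Defs.orthomx (u k).
  by move=> hk; apply: padI_ortho; [exact: hN|exact: hU].
set w := fun l => padm N (W l).
have seg m k : (m + k <= n.+2)%N ->
    segw (fun l => padm N ((U l.+1)^T *m W l *m U l)) m k =
    (u (m + k)%N)^T *m segw w m k *m u m.
  move=> hmk; rewrite -segw_conj => [|k' hk']; last by apply: hu; lia.
  by apply: eq_segw => k' hk'; rewrite pad_conj //; lia.
have hE : padres d n lam y (fun l => padm N ((U l.+1)^T *m W l *m U l)) =
    (u n.+2)^T *m padres d n lam y w *m u 0.
  rewrite /padres seg // mulmxBr mulmxBl; congr (_ - _).
  rewrite -scalemxAr -scalemxAl; congr (_ *: _).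
  rewrite /u -padI_tr padI_padm ?hN // padm_padI ?hN //.
  by rewrite -mulmxA -hY mulmxA ortho_trl ?mul1mx //; apply: hU.
have e : (l.+1 + (n.+1 - l) = n.+2)%N by lia.
rewrite /padgrad hE !seg ?e ?add0n; [|lia|lia].
move: (padres _ _ _ _ w) => Ep.
rewrite pad_conj // -scalemxAr -scalemxAl.
rewrite mulmx_affine; congr (_ *: (_ + _)).
rewrite !trmx_mul !trmxK !mulmxA; congr (_ *m _).
rewrite -!mulmxA; congr (_ *m (_ *m _)).
have uL : u n.+2 *m (u n.+2)^T = 1%:M by apply: hu.
have u0 : u 0 *m (u 0)^T = 1%:M by apply: hu.
by rewrite (mulmxA (u n.+2)) uL mul1mx (mulmxA (u 0)) u0 mul1mx.
Qed.

End Conjugation.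

(** * Diagonal and permutation blocks as padded matrices *)

Section OrbitDescription.
Context (R : realType).

Definition padv N k (a : 'cV[R]_k) : 'rV[R]_N :=
  \row_i oapp (fun i' : 'I_k => a i' 0) 0 (insub (val i)).

Lemma Sigmx_pid k p q (a : 'cV[R]_k) :
  Sigmx p q a = pid_mx k *m diag_mx a^T *m pid_mx k.
Proof.
apply/matrixP => i j; rewrite mul_mx_diag !mxE.
case: insubP => [i' hi ei|hi] /=; last first.
  rewrite if_same big1 // => s _; rewrite !mxE (_ : (i < k)%N = false) ?andbF ?mul0r //.
  exact: negbTE.
rewrite (bigD1 i') //= !mxE ei eqxx hi andbT mul1r big1 ?addr0 => [|s ns].
  by case: eqP; rewrite ?mulr1 ?mulr0.
by rewrite !mxE -ei (val_eqE i' s) eq_sym (negPf ns) !mul0r.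
Qed.

Lemma padm_diag N k (a : 'cV[R]_k) : (k <= N)%N ->
  padm N (diag_mx a^T) = diag_mx (padv N a).
Proof.
move=> h; rewrite /padm -Sigmx_pid; apply/matrixP => i j; rewrite !mxE.
by rewrite val_eqE; case: eqP => [->|_]; rewrite ?mulr1n ?mulr0n.
Qed.

Lemma padm_Sigmx N k p q (a : 'cV[R]_k) : (k <= p)%N -> (k <= q)%N ->
  (p <= N)%N -> (q <= N)%N -> padm N (Sigmx p q a) = diag_mx (padv N a).
Proof.
move=> kp kq pN qN; rewrite -padm_diag ?(leq_trans kp) // /padm Sigmx_pid !mulmxA.
rewrite mul_pid_mx -!mulmxA mul_pid_mx !mulmxA.
by rewrite (minn_idPr kp) (minn_idPr kp) (minn_idPl kq) (minn_idPr kq).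
Qed.

Lemma diagY_Sigmx p q k (y : nat -> R) : k = minn q p ->
  diagY p q y = Sigmx p q (\col_(i < k) y i).
Proof.
move=> ek; apply/matrixP => i j; rewrite !mxE; case: eqP => // e.
case: insubP => [i' _ <-|]; first by rewrite /= mxE.
by rewrite ek leq_min ltn_ord /= e ltn_ord.
Qed.

Lemma blkI_padI k m (P : 'M[R]_k) : blkI m P = padI m P.
Proof.
apply/matrixP => i j.
have -> : padI m P i j = (i == j)%:R - ((i == j :> nat) && (i < k)%N)%:R + padm m P i j.
  by rewrite /padI; move: (padm m P) => M; rewrite !mxE.
rewrite mxE val_eqE; case: insubP => [i' _ ei|hi]; last first.
  by rewrite -leqNgt in hi; rewrite pad_entry_row // ltnNge hi andbF subr0 addr0.
case: insubP => [j' _ ej|hj].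
  rewrite (pad_entry P ei ej) -ei ltn_ord andbT.
  by rewrite subrr add0r.
rewrite -leqNgt in hj; rewrite pad_entry_col // addr0.
case: eqP => [e|_] /=; last by rewrite subrr.
by move: hj; rewrite -e -ei leqNgt ltn_ord.
Qed.

Lemma padI_pid k m (P : 'M[R]_k) : (k <= m)%N ->
  padI m P *m (pid_mx k : 'M[R]_(m, k)) = pid_mx k *m P.
Proof.
move=> h; rewrite /padI /padm mulmxDl mulmxBl mul1mx -!mulmxA pid_retract //.
by rewrite mulmx1 mul_pid_mx !minnn (minn_idPr h) subrr add0r.
Qed.

Lemma perm_tr_entry k (s : {perm 'I_k}) (sig : 'cV[R]_k) i :
  ((perm_mx s)^T *m sig) (s i) 0 = sig i 0.
Proof. by rewrite tr_perm_mx -row_permE mxE permK. Qed.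

Lemma perm_diag k (s : {perm 'I_k}) (sig : 'cV[R]_k) (P : 'M[R]_k := perm_mx s) :
  P *m diag_mx (P^T *m sig)^T = diag_mx sig^T *m P.
Proof.
apply/matrixP => i j; rewrite mul_mx_diag mul_diag_mx mxE [RHS]mxE [X in _ * X = _]mxE.
rewrite [X in _ = X * _]mxE /P [perm_mx s i j]mxE mxE.
by case: eqP => [<-|_]; rewrite ?mulr0 ?mul0r // perm_tr_entry mulr1 mul1r.
Qed.

Lemma perm_ortho k (s : {perm 'I_k}) : Defs.orthomx (perm_mx s : 'M[R]_k).
Proof. by rewrite /Defs.orthomx tr_perm_mx -perm_mxM mulgV perm_mx1. Qed.

Lemma perm_Sigmx k p q (s : {perm 'I_k}) (sig : 'cV[R]_k) (P : 'M[R]_k := perm_mx s) :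
  (k <= p)%N -> (k <= q)%N ->
  blkI p P *m Sigmx p q (P^T *m sig) = Sigmx p q sig *m blkI q P.
Proof.
move=> kp kq; rewrite !Sigmx_pid !blkI_padI !mulmxA padI_pid //.
rewrite -(mulmxA (pid_mx k)) perm_diag -!mulmxA; congr (_ *m (_ *m _)).
by apply: trmx_inj; rewrite !trmx_mul -padI_tr !tr_pid_mx padI_pid.
Qed.

(** Pointwise update of a family whose type depends on the index: the new value is transported along
    a decided equality, which is harmless since equality proofs on [nat] are unique. *)
Lemma dep_update (d : nat -> nat) (F : forall l, 'M[R]_(d l)) k (M : 'M[R]_(d k)) :
  exists F' : forall l, 'M[R]_(d l), F' k = M /\ forall l, l != k -> F' l = F l.
Proof.
exists (fun l => match @eqP _ k l with
  | ReflectT e => eq_rect k (fun l => 'M[R]_(d l)) M l e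
  | ReflectF _ => F l end); split.
  by case: eqP => // e; rewrite (eq_irrelevance e (erefl k)).
by move=> l nl; case: eqP => // e; rewrite e eqxx in nl.
Qed.

End OrbitDescription.

(** * Shared diagonal blocks as commutation with the target *)

Section SetDescription.
Context (R : realType).

(** A downward closed predicate holds on an initial segment, whose length is the count. For sorted
    [y] this turns [i < rY] into positivity of [y i]. *)
Lemma count_iota_downward (P : pred nat) k :
  (forall i j, (i <= j < k)%N -> P j -> P i) ->
  forall i, (i < k)%N -> (i < count P (iota 0 k))%N = P i.
Proof.
elim: k => // k IH hP i.
have -> : count P (iota 0 k.+1) = (count P (iota 0 k) + P k)%N.
  by rewrite -addn1 iotaD count_cat /= addn0.
rewrite ltnS leq_eqVlt.
have hP' i' j : (i' <= j < k)%N -> P j -> P i'.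
  by move=> h; apply: hP; lia.
have le_k : (count P (iota 0 k) <= k)%N by rewrite -[leqRHS](size_iota 0 k) count_size.
have [Pk|nPk] := boolP (P k); last first.
  rewrite addn0; case: eqP => [->|_] /= ltik; last exact: IH.
  by rewrite (negPf nPk) ltnNge le_k.
move=> hik; have ik : (i <= k)%N by case/orP: hik => [/eqP->//|/ltnW].
have -> : count P (iota 0 k) = k.
  apply/eqP; rewrite -[X in _ == X](size_iota 0 k) -all_count; apply/allP => j.
  by rewrite mem_iota add0n => /andP[_ jk]; apply: (hP j k) => //; lia.
by rewrite addn1 ltnS ik; apply/esym/(hP i k) => //; lia.
Qed.

Context (p q k : nat) (y : nat -> R).
Hypotheses (ek : k = minn q p)
  (y_sorted : forall i j : nat, (i <= j < k)%N -> y j <= y i)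
  (y_ge0 : forall i : nat, (i < k)%N -> 0 <= y i).

Let N := maxn p q.
Let pN : (p <= N)%N. Proof. exact: leq_maxl. Qed.
Let qN : (q <= N)%N. Proof. exact: leq_maxr. Qed.
Let kp : (k <= p)%N. Proof. by rewrite ek geq_minr. Qed.
Let kq : (k <= q)%N. Proof. by rewrite ek geq_minl. Qed.
Local Notation r := (rY k y).
Local Notation ycol := (\col_(i < k) y i : 'cV[R]_k).

Lemma lt_rY i : (i < k)%N -> (i < r)%N = (0 < y i).
Proof.
apply: (@count_iota_downward (fun i => 0 < y i)) => i' j h /lt_le_trans; apply.
exact: y_sorted.
Qed.

Lemma rY_le : (r <= k)%N.
Proof. by rewrite /rY -[leqRHS](size_iota 0 k) count_size. Qed.

Lemma padv_y_lt M (i : 'I_M) : (i < k)%N -> padv M ycol 0 i = y i.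
Proof.
move=> h; rewrite mxE; case: insubP => [i' _ /= <-|]; first by rewrite mxE.
by rewrite h.
Qed.

Lemma padv_ge M (a : 'cV[R]_k) (i : 'I_M) : (k <= i)%N -> padv M a 0 i = 0.
Proof. by move=> h; rewrite mxE; case: insubP => // i' h'; move: h'; rewrite ltnNge h. Qed.

Lemma padv_y_ge_rY M (i : 'I_M) : (r <= i)%N -> padv M ycol 0 i = 0.
Proof.
move=> h; have [ik|ki] := ltnP i k; last exact: padv_ge.
rewrite padv_y_lt //; apply/le_anti; rewrite y_ge0 // andbT leNgt -lt_rY //.
by rewrite -leqNgt.
Qed.

Lemma padv_y_gt0 M (i : 'I_M) : (i < r)%N -> 0 < padv M ycol 0 i.
Proof.
by move=> h; have ik := leq_trans h rY_le; rewrite padv_y_lt // -lt_rY.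
Qed.

Lemma pad_diagY : padm N (diagY p q y) = diag_mx (padv N ycol).
Proof. by rewrite (@diagY_Sigmx _ _ _ k) // padm_Sigmx. Qed.

Lemma blkdiag_pad m (O : 'M[R]_m) (i j : 'I_N) : blkdiag_y r y O ->
  ~~ same_blk r y i j -> padm N O i j = 0.
Proof.
move=> hO hij; have [im|mi] := ltnP i m; last by rewrite pad_entry_row.
have [jm|mj] := ltnP j m; last by rewrite pad_entry_col.
by rewrite (@pad_entry _ _ _ _ _ (Ordinal im) (Ordinal jm)) //; apply: hO.
Qed.

Lemma commute_pad (O : 'M[R]_q) (Oh : 'M[R]_p) :
  Oh *m diagY p q y = diagY p q y *m O <->
  forall i j, padm N Oh i j * padv N ycol 0 j = padv N ycol 0 i * padm N O i j.
Proof.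
split=> [e i j|h].
  have /(congr1 (fun M => padm N M)) := e; rewrite !padM // pad_diagY => /matrixP /(_ i j).
  by rewrite mul_mx_diag mul_diag_mx mxE [RHS]mxE.
rewrite -[LHS](@padK _ N) // -[RHS](@padK _ N) //; congr unpad.
by rewrite !padM // pad_diagY; apply/matrixP => i j; rewrite mul_mx_diag mul_diag_mx mxE [RHS]mxE h.
Qed.

Lemma commute_tr (O : 'M[R]_q) (Oh : 'M[R]_p) : Defs.orthomx O -> Defs.orthomx Oh ->
  Oh *m diagY p q y = diagY p q y *m O ->
  Oh^T *m diagY p q y = diagY p q y *m O^T.
Proof.
move=> hO hOh e; rewrite -[LHS]mulmx1 -hO mulmxA -(mulmxA _ _ O) -e mulmxA.
by rewrite ortho_trl // mul1mx.
Qed.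

(** Entrywise, commutation reads [Oh_ij v_j = v_i O_ij]; by orthogonality the transposes commute as
    well, so [Oh_ij v_i = v_j O_ij]. Together these multiply [O_ij] and [Oh_ij] by [v_i^2 - v_j^2],
    which kills entries between different blocks, while inside a positive block the common value
    cancels and the two blocks agree. *)
Lemma blocks_commute (O : 'M[R]_q) (Oh : 'M[R]_p) :
  Defs.orthomx O -> Defs.orthomx Oh ->
  (blkdiag_y r y O /\ blkdiag_y r y Oh /\
   (forall (i j : 'I_q) (i' j' : 'I_p),
      val i = val i' -> val j = val j' -> (i < r)%N -> (j < r)%N -> O i j = Oh i' j'))
  <-> Oh *m diagY p q y = diagY p q y *m O.
Proof.
move=> hO hOh; have rk := rY_le; split=> [[bO [bOh hs]]|e].
  apply/commute_pad => i j.
  have [ir|ri] := ltnP i r; have [jr|rj] := ltnP j r.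
  - have [eij|nij] := eqVneq (y i) (y j); last first.
      have nb : ~~ same_blk r y i j by rewrite /same_blk ir jr.
      by rewrite !(blkdiag_pad _ nb) // mulr0 mul0r.
    have iq : (i < q)%N by lia. have jq : (j < q)%N by lia.
    have ip : (i < p)%N by lia. have jp : (j < p)%N by lia.
    rewrite !padv_y_lt; [|lia|lia].
    rewrite (@pad_entry _ _ _ _ O (Ordinal iq) (Ordinal jq)) //.
    rewrite (@pad_entry _ _ _ _ Oh (Ordinal ip) (Ordinal jp)) //.
    by rewrite (hs _ _ (Ordinal ip) (Ordinal jp)) // eij mulrC.
  - have nb : ~~ same_blk r y i j by rewrite /same_blk ir /= ltnNge rj /= leqNgt ir.
    by rewrite (blkdiag_pad bO nb) mulr0 padv_y_ge_rY // mulr0.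
  - have nb : ~~ same_blk r y i j by rewrite /same_blk ltnNge ri /= leqNgt jr.
    by rewrite (blkdiag_pad bOh nb) mul0r padv_y_ge_rY // mul0r.
  - by rewrite !padv_y_ge_rY // mulr0 mul0r.
have c1 := proj1 (commute_pad O Oh) e.
have c2 i j : padm N Oh i j * padv N ycol 0 i = padv N ycol 0 j * padm N O i j.
  have := proj1 (commute_pad O^T Oh^T) (commute_tr hO hOh e) j i.
  by rewrite !pad_tr ![_^T _ _]mxE.
have v_ge0 (i : 'I_N) : 0 <= padv N ycol 0 i.
  have [ir|ri] := ltnP i r; first exact/ltW/padv_y_gt0.
  by rewrite padv_y_ge_rY.
have zero (i j : 'I_N) : padv N ycol 0 i != padv N ycol 0 j ->
    padm N O i j = 0 /\ padm N Oh i j = 0.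
  move=> nij; have nz : padv N ycol 0 i ^+ 2 - padv N ycol 0 j ^+ 2 != 0.
    by rewrite subr_eq0 eqrXn2.
  have h1 := c1 i j; have h2 := c2 i j.
  split; apply: (mulfI nz); rewrite mulr0.
    rewrite mulrBl !expr2 -!mulrA -h1 -h2; ring.
  rewrite mulrBl !expr2 -!mulrA ![_ * padm N Oh i j]mulrC h1 h2; ring.
have neq_y (i j : 'I_N) : ~~ same_blk r y i j -> padv N ycol 0 i != padv N ycol 0 j.
  rewrite /same_blk; have [ir|ri] := ltnP i r; have [jr|rj] := ltnP j r => //= nij.
  - by rewrite !padv_y_lt //; apply: (leq_trans _ rk).
  - by rewrite (padv_y_ge_rY rj) gt_eqF // padv_y_gt0.
  - by rewrite (padv_y_ge_rY ri) lt_eqF // padv_y_gt0.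
split; last split.
- move=> i j nb; have /neq_y/zero[z _] : ~~ same_blk r y (widen_ord qN i) (widen_ord qN j) by [].
  by rewrite -z; apply: esym; apply: pad_entry.
- move=> i j nb; have /neq_y/zero[_ z] : ~~ same_blk r y (widen_ord pN i) (widen_ord pN j) by [].
  by rewrite -z; apply: esym; apply: pad_entry.
move=> i j i' j' ei ej ir jr.
have := c1 (widen_ord qN i) (widen_ord qN j).
rewrite (@pad_entry _ _ _ _ O i j) // (@pad_entry _ _ _ _ Oh i' j') //.
have [eij|nij] := eqVneq (padv N ycol 0 (widen_ord qN i)) (padv N ycol 0 (widen_ord qN j)).
  have vj : padv N ycol 0 (widen_ord qN j) != 0 by rewrite gt_eqF // padv_y_gt0.
  by rewrite eij mulrC => /(mulfI vj).
have [z1 z2] := zero _ _ nij => _.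
rewrite -(@pad_entry _ _ _ _ O i j (widen_ord qN i) (widen_ord qN j)) // z1.
by rewrite -(@pad_entry _ _ _ _ Oh i' j' (widen_ord qN i) (widen_ord qN j)).
Qed.

End SetDescription.

(** * The critical set as a union of orbits *)

Section SetWsig.
Context (R : realType) (n : nat) (d : nat -> nat) (lam : R) (y : nat -> R).
Local Notation k := (minn (d 0) (d n.+2)).
Local Notation Y := (diagY (d n.+2) (d 0) y).
Hypotheses (y_sorted : forall i j : nat, (i <= j < k)%N -> y j <= y i)
  (y_ge0 : forall i : nat, (i < k)%N -> 0 <= y i)
  (hd : forall l : nat, (1 <= l <= n.+1)%N -> (k <= d l)%N).

Lemma dmin_le l : (l <= n.+2)%N -> (k <= d l)%N.
Proof.
case: l => [|l] hl; first exact: geq_minl.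
have [->|nl] := eqVneq l n.+1; first exact: geq_minr.
by apply: hd; lia.
Qed.

(** The invariance group of the objective: inner factors are free, the two outer ones are tied
    together by the target. *)
Definition symmetry (U : forall l, 'M[R]_(d l)) :=
  (forall l, (l <= n.+2)%N -> Defs.orthomx (U l)) /\ U n.+2 *m Y = Y *m U 0.

Definition orbit_pt (a : 'cV[R]_k) (U : forall l, 'M[R]_(d l)) : wtuple R d :=
  fun l => U l.+1 *m Sigmx _ _ a *m (U l)^T.

Lemma ortho_tr p (U : 'M[R]_p) : Defs.orthomx U -> Defs.orthomx U^T.
Proof. by move=> h; rewrite /Defs.orthomx trmxK ortho_trl. Qed.

Lemma orthoM p (U V : 'M[R]_p) : Defs.orthomx U -> Defs.orthomx V -> Defs.orthomx (U *m V).
Proof.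
move=> hU hV; rewrite /Defs.orthomx trmx_mul mulmxA -(mulmxA U).
by rewrite [V *m V^T]hV mulmx1.
Qed.

(** Commuting the permutation block through [Sigmx] replaces [sig] by its permuted version, after
    which the block can be absorbed into the inner orthogonal factors. *)
Lemma setWsigP (sig : 'cV[R]_k) (W : wtuple R d) :
  setWsig d n lam y sig W <->
  exists (s : {perm 'I_k}) U, [/\ setA n.+2 lam y ((perm_mx s)^T *m sig), symmetry U &
    forall l, (l < n.+2)%N -> W l = orbit_pt ((perm_mx s)^T *m sig) U l].
Proof.
have k0 : (k <= d 0)%N := geq_minl _ _; have kL : (k <= d n.+2)%N := geq_minr _ _.
have padPT m (P : 'M[R]_k) : blkI m P^T = (blkI m P)^T by rewrite !blkI_padI padI_tr.
have blkO s m : (k <= m)%N -> Defs.orthomx (blkI m (perm_mx s : 'M[R]_k)).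
  by move=> h; rewrite blkI_padI; apply: padI_ortho => //; apply: perm_ortho.
have facts (s : {perm 'I_k}) (a := (perm_mx s)^T *m sig)
    (P := fun m => blkI m (perm_mx s : 'M[R]_k)) :
    (forall i j, (i <= n.+2)%N -> (j <= n.+2)%N ->
      P (d i) *m Sigmx (d i) (d j) a = Sigmx (d i) (d j) sig *m P (d j)) /\
    (forall i, (i <= n.+2)%N -> P (d i) *m (P (d i))^T = 1%:M).
  split; first by move=> i j hi hj; rewrite perm_Sigmx ?dmin_le.
  by move=> i hi; apply: blkO; apply: dmin_le.
have facts' (s : {perm 'I_k}) (a := (perm_mx s)^T *m sig)
    (P := fun m => blkI m (perm_mx s : 'M[R]_k)) i j :
    (i <= n.+2)%N -> (j <= n.+2)%N ->
      Sigmx (d i) (d j) a *m (P (d j))^T = (P (d i))^T *m Sigmx (d i) (d j) sig.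
  have [PS PP] := facts s; rewrite -/P in PS PP.
  move=> hi hj; rewrite -[LHS]mul1mx -(ortho_trl (PP i hi)) -mulmxA; congr (_ *m _).
  by rewrite mulmxA PS // -mulmxA PP // mulmx1.
split.
  move=> [s [Q [B [Bh [hA [hQ [hO [bO [hOh [bOh [hs [W0 [Wl WL]]]]]]]]]]]]].
  set a := (perm_mx s)^T *m sig in hA *; pose P m := blkI m (perm_mx s : 'M[R]_k).
  (* Witness: [Q l] times the permutation block at inner indices, [Bh^T] at the last and [B^T] at
     the first; the converse direction undoes the inner product. *)
  have [U1 [U1L U1n]] := dep_update (fun l => Q l *m P (d l)) (Bh^T : 'M[R]_(d n.+2)).
  have [U [U0 Un]] := dep_update U1 (B^T : 'M[R]_(d 0)).
  have UL : U n.+2 = Bh^T by rewrite Un.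
  have Ul l : (1 <= l <= n.+1)%N -> U l = Q l *m P (d l).
    by move=> hl; rewrite Un ?U1n //; lia.
  exists s, U; split => //.
    split=> [l hl|].
      have [l0|l_gt0] := posnP l; first by rewrite l0 U0; apply: ortho_tr.
      have [->|nl] := eqVneq l n.+2; first by rewrite UL; apply: ortho_tr.
      have hl' : (1 <= l <= n.+1)%N by lia.
      by rewrite Ul //; apply: orthoM; [apply: hQ|apply: blkO; apply: dmin_le].
    rewrite UL U0; apply: commute_tr => //.
    by apply/(@blocks_commute _ _ _ k y erefl).
  move=> l hl; rewrite /orbit_pt -/a.
  have [PS PP] := facts s; have SP := facts' s; rewrite -/a -/P in PS PP SP.
  have [l0|l_gt0] := posnP l.
    by rewrite l0 W0 Ul // U0 trmxK -!mulmxA [P _ *m (_ *m _)]mulmxA PS // !mulmxA.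
  have [->|nl] := eqVneq l n.+1.
    by rewrite WL UL Ul ?leqnn // trmx_mul -(mulmxA _ _ (_ *m _))
      [Sigmx _ _ a *m _]mulmxA SP // padPT !mulmxA.
  rewrite Wl; last by lia.
  rewrite !Ul; [|lia|lia].
  rewrite trmx_mul -!mulmxA; congr (_ *m _).
  rewrite [Sigmx _ _ a *m _]mulmxA SP ?(mulmxA (P _)) ?(mulmxA (P _ *m _)) ?PP ?mul1mx //; lia.
move=> [s [U [hA [hU hY] hW]]].
set a := (perm_mx s)^T *m sig in hA hW; pose P m := blkI m (perm_mx s : 'M[R]_k).
have [PS PP] := facts s; have SP := facts' s; rewrite -/a -/P in PS PP SP.
have hO : Defs.orthomx (U 0)^T by apply: ortho_tr; apply: hU.
have hOh : Defs.orthomx (U n.+2)^T by apply: ortho_tr; apply: hU.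
have [b0 [bL hs]] := (@blocks_commute _ _ _ k y erefl y_sorted y_ge0 _ _ hO hOh).2
  (commute_tr (hU 0 isT) (hU _ (leqnn _)) hY).
have PtP i : (i <= n.+2)%N -> (P (d i))^T *m P (d i) = 1%:M.
  by move=> hi; apply: ortho_trl; apply: PP.
exists s, (fun l => U l *m (P (d l))^T), (U 0)^T, (U n.+2)^T.
do !split=> //.
- move=> l hl; apply: orthoM; first by apply: hU; lia.
  by apply: ortho_tr; apply: PP; lia.
- by rewrite hW // /orbit_pt -/a -/(P _) -!mulmxA (mulmxA (Sigmx _ _ _)) -PS // !mulmxA
    -(mulmxA _ _ (P _)) PtP // mulmx1.
- move=> l hl; rewrite hW; last by lia.
  rewrite /orbit_pt -/a trmx_mul trmxK -!mulmxA (mulmxA (Sigmx _ _ _)) -PS; [|lia|lia].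
  by rewrite !mulmxA -(mulmxA _ _ (P _)) PtP ?mulmx1 //; lia.
rewrite hW // /orbit_pt -/a trmx_mul !trmxK -!mulmxA (mulmxA (Sigmx _ _ _)) -PS //.
by rewrite padPT -/(P _) !mulmxA -(mulmxA _ _ (P _)) PtP // mulmx1.
Qed.

End SetWsig.

(** * Plane rotations as test directions *)

Section Rotation.
Context (R : realType).

Definition rot m (i j : 'I_m) (c s : R) : 'M[R]_m :=
  1%:M + (c - 1) *: (delta_mx i i + delta_mx j j) + s *: (delta_mx i j - delta_mx j i).

(** In the plane of [i] and [j], the matrices [P] and [K] below multiply like 1 and the imaginary
    unit, and [K] is antisymmetric, so the claim reduces to [c^2 + s^2 = 1]. *)
Lemma rot_ortho m (i j : 'I_m) c s : i != j -> c ^+ 2 + s ^+ 2 = 1 ->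
  Defs.orthomx (rot i j c s).
Proof.
move=> ij cs; have ji : j != i by rewrite eq_sym.
pose P : 'M[R]_m := delta_mx i i + delta_mx j j.
pose K : 'M[R]_m := delta_mx i j - delta_mx j i.
have PT : P^T = P by rewrite /P linearD /= !trmx_delta.
have KT : K^T = - K by rewrite /K linearB /= !trmx_delta opprB.
have PP : P *m P = P.
  by rewrite /P mulmxDl !mulmxDr !mul_delta_mx_cond !eqxx
       (negPf ij) (negPf ji) !mulr1n !mulr0n addr0 add0r.
have PK : P *m K = K.
  by rewrite /P /K mulmxDl !mulmxBr !mul_delta_mx_cond !eqxx
       (negPf ij) (negPf ji) !mulr1n !mulr0n subr0 sub0r.
have KP : K *m P = K.
  by rewrite -[K *m P]trmxK trmx_mul PT KT mulmxN PK linearN /= KT opprK.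
have KK : K *m K = - P.
  by rewrite /P /K mulmxBl !mulmxBr !mul_delta_mx_cond !eqxx
       (negPf ij) (negPf ji) !mulr1n !mulr0n subr0 sub0r opprD.
have cs' : (c - 1) + (c - 1) + (c - 1) * (c - 1) + s * s = 0 by rewrite -!expr2; lra.
have rE : rot i j c s = 1%:M + (c - 1) *: P + s *: K by [].
clearbody P K; have rT : (rot i j c s)^T = 1%:M + (c - 1) *: P - s *: K.
  by rewrite rE !linearD !linearZ /= trmx1 PT KT scalerN.
rewrite /Defs.orthomx rT rE.
rewrite mulmxBr !mulmxDr !mulmxDl !mul1mx !mulmx1 -!scalemxAl -!scalemxAr.
rewrite PP PK KP KK !scalerN.
transitivity (1%:M + ((c - 1) + (c - 1) + (c - 1) * (c - 1) + s * s) *: P).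
  by apply/matrixP => p q; rewrite !mxE; ring.
by rewrite cs' scale0r addr0.
Qed.

(* Testing the two rotations of parameter [t = tau] and [t = - tau], with
   [c = (1 - t^2) / (1 + t^2)] and [s = 2 t / (1 + t^2)], turns approximate
   minimality along the circle into an approximate first-order condition. *)
Lemma first_order_circle (A B tau : R) : 0 < tau <= 1 ->
  (forall c s, c ^+ 2 + s ^+ 2 = 1 -> (c - 1) * A + s * B <= tau ^+ 2 / 2) ->
  `|B| <= tau * (2^-1 + `|A|).
Proof.
move=> /andP[t0 t1] h.
have key t : t ^+ 2 = tau ^+ 2 -> t * B <= tau * (tau * (2^-1 + `|A|)).
  move=> et; have p : 0 < 1 + t ^+ 2 by rewrite ltr_pwDl // sqr_ge0.
  have p0 : 1 + t ^+ 2 != 0 by rewrite gt_eqF.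
  have := h ((1 - t ^+ 2) / (1 + t ^+ 2)) (2 * t / (1 + t ^+ 2)) ltac:(by field).
  have -> : ((1 - t ^+ 2) / (1 + t ^+ 2) - 1) * A + 2 * t / (1 + t ^+ 2) * B =
    (2 * t * B - 2 * t ^+ 2 * A) / (1 + t ^+ 2) by field.
  rewrite ler_pdivrMr // et => {}h.
  have nA := ler_norm A; have tt : tau ^+ 2 <= 1 by rewrite expr_le1 // ltW.
  have t2 : 0 <= tau ^+ 2 by exact: sqr_ge0.
  have : tau ^+ 2 * A <= tau ^+ 2 * `|A| by rewrite ler_wpM2l.
  have : tau ^+ 2 * tau ^+ 2 <= tau ^+ 2 * 1 by rewrite ler_wpM2l.
  rewrite !expr2 in h *; lra.
rewrite -(ler_pM2l t0); have h1 := key tau erefl; have h2 := key (- tau) (sqrrN _).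
by case: (ger0P B) => _ //; rewrite mulrN -mulNr.
Qed.

Lemma tr_mul_delta p q (X : 'M[R]_(p, q)) i j : \tr (X^T *m delta_mx i j) = X i j.
Proof.
rewrite -frobdotE /frobdot.
rewrite (bigD1 i) //= (bigD1 j) //= mxE !eqxx mulr1.
rewrite !big1 ?addr0 // => [p' /negPf np|q' /negPf nq].
  by rewrite big1 // => q' _; rewrite mxE np mulr0.
by rewrite mxE nq andbF mulr0.
Qed.

Lemma frobdot_delta_l N p q k (a : 'cV[R]_k) (M : 'M[R]_(p, q)) (i j : 'I_p) (I J : 'I_N) :
  (k <= p)%N -> (k <= q)%N -> (p <= N)%N -> (q <= N)%N ->
  i = I :> nat -> j = J :> nat ->
  frobdot M (delta_mx i j *m Sigmx p q a) = padm N M I J * padv N a 0 J.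
Proof.
move=> kp kq pN qN ei ej.
have -> : frobdot M (delta_mx i j *m Sigmx p q a) = (M *m (Sigmx p q a)^T) i j.
  rewrite -[_ *m Sigmx p q a]mul1mx mulmxA frobdot_adj trmx1 mul1mx frobdotE.
  exact: tr_mul_delta.
rewrite -(pad_entry _ ei ej) padM // pad_tr padm_Sigmx // tr_diag_mx mul_mx_diag.
by rewrite mxE.
Qed.

Lemma frobdot_delta_r N p q k (a : 'cV[R]_k) (M : 'M[R]_(p, q)) (i j : 'I_q) (I J : 'I_N) :
  (k <= p)%N -> (k <= q)%N -> (p <= N)%N -> (q <= N)%N ->
  i = I :> nat -> j = J :> nat ->
  frobdot M (Sigmx p q a *m delta_mx i j) = padv N a 0 I * padm N M I J.
Proof.
move=> kp kq pN qN ei ej.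
have -> : frobdot M (Sigmx p q a *m delta_mx i j) = ((Sigmx p q a)^T *m M) i j.
  rewrite -[_ *m delta_mx i j]mulmx1 frobdot_adj trmx1 mulmx1 frobdotE.
  exact: tr_mul_delta.
rewrite -(pad_entry _ ei ej) padM // pad_tr padm_Sigmx // tr_diag_mx mul_diag_mx.
by rewrite mxE.
Qed.

End Rotation.

(** * Approximate orthogonality of a nearly closest point to the orbit *)

Section NearMinimizer.
Context (R : realType) (n : nat) (d : nat -> nat) (y : nat -> R) (N : nat).
Local Notation k := (minn (d 0) (d n.+2)).
Local Notation Y := (diagY (d n.+2) (d 0) y).
Hypotheses (kd : forall l, (l <= n.+2)%N -> (k <= d l)%N)
  (hN : forall l, (l <= n.+2)%N -> (d l <= N)%N).
Context (a : 'cV[R]_k) (U : forall l, 'M[R]_(d l)) (W : wtuple R d) (tau : R).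
Hypotheses (hU : symmetry n y U) (tau_itv : 0 < tau <= 1)
  (near_min : forall U', symmetry n y U' ->
     \sum_(l < n.+2) frob2 (W l - orbit_pt a U l) - tau ^+ 2 <=
     \sum_(l < n.+2) frob2 (W l - orbit_pt a U' l)).

Let W' l := (U l.+1)^T *m W l *m U l.
Let S l : 'M[R]_(d l.+1, d l) := Sigmx (d l.+1) (d l) a.
Local Notation α i := (padv N a 0 i).
Local Notation w l := (padm N (W' l)).

Lemma frob2_sub p q (A B : 'M[R]_(p, q)) :
  frob2 (A - B) = frob2 A - 2 * frobdot A B + frob2 B.
Proof.
rewrite !frob2E frobdotBr -scaleN1r !frobdotDl !frobdotZl (frobdotC B A); ring.
Qed.

Lemma frob2_conj l X : (l < n.+2)%N ->
  frob2 (W l - U l.+1 *m X *m (U l)^T) = frob2 (W' l - X).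
Proof.
move=> hl; have [oU _] := hU.
have o1 := oU l.+1 hl; have o0 := oU l (ltnW hl).
rewrite -(frob2_ortho _ o1 o0) /W' mulmxBr mulmxBl !mulmxA ortho_trl // mul1mx.
by rewrite -(mulmxA X) ortho_trl // mulmx1.
Qed.

(** All orbit points have the same norm, so in the comparison of squared distances only the cross
    terms survive; each carries a factor 2, which halves the slack. *)
Lemma near_rot (P : forall l, 'M[R]_(d l)) : symmetry n y P ->
  \sum_(l < n.+2) frobdot (W' l) (P l.+1 *m S l *m (P l)^T - S l) <= tau ^+ 2 / 2.
Proof.
move=> [oP cP]; have [oU cU] := hU.
have sym : symmetry n y (fun l => U l *m P l).
  split=> [l hl|]; first by apply: orthoM; [apply: oU|apply: oP].
  by rewrite -mulmxA cP mulmxA cU mulmxA.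
have := near_min sym; rewrite lerBlDr -lerBlDl -sumrB => h.
suff -> : \sum_(l < n.+2) frobdot (W' l) (P l.+1 *m S l *m (P l)^T - S l) =
    (\sum_(l < n.+2) (frob2 (W l - orbit_pt a U l) -
       frob2 (W l - orbit_pt a (fun l => U l *m P l) l))) / 2.
  by rewrite ler_pM2r.
rewrite mulr_suml; apply: eq_bigr => l _; have hl := ltn_ord l.
rewrite /orbit_pt frob2_conj //.
have -> : U l.+1 *m P l.+1 *m Sigmx (d l.+1) (d l) a *m (U l *m P l)^T =
    U l.+1 *m (P l.+1 *m S l *m (P l)^T) *m (U l)^T by rewrite trmx_mul !mulmxA.
rewrite frob2_conj // !frob2_sub frobdotBr.
have oPl1 := ortho_tr (oP l.+1 hl); have oPl := ortho_tr (oP l (ltnW hl)).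
have := frob2_ortho (S l) oPl1 oPl; rewrite trmxK => ->.
by rewrite -/(S l); field.
Qed.

Lemma sum_two_terms (F : nat -> R) (m p q : nat) : (p < m)%N -> (q < m)%N -> p != q ->
  (forall l, (l < m)%N -> l != p -> l != q -> F l = 0) ->
  \sum_(l < m) F l = F p + F q.
Proof.
move=> pm qm npq z; rewrite (bigD1 (Ordinal pm)) //= (bigD1 (Ordinal qm)) /=; last first.
  by rewrite -val_eqE /= eq_sym.
by rewrite big1 ?addr0 // => l /andP[h1 h2]; apply: z.
Qed.

Lemma frobdot_rot_l p q (M X : 'M[R]_(p, q)) (i j : 'I_p) c s :
  frobdot M (rot i j c s *m X - X) =
  (c - 1) * (frobdot M (delta_mx i i *m X) + frobdot M (delta_mx j j *m X))
  + s * (frobdot M (delta_mx i j *m X) - frobdot M (delta_mx j i *m X)).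
Proof.
rewrite /rot !mulmxDl mul1mx addrAC [X + _]addrC addrK -!scalemxAl frobdotDr !frobdotZr.
by rewrite mulmxBl mulmxDl frobdotDr frobdotBr; ring.
Qed.

Lemma frobdot_rot_r p q (M X : 'M[R]_(p, q)) (i j : 'I_q) c s :
  frobdot M (X *m (rot i j c s)^T - X) =
  (c - 1) * (frobdot M (X *m delta_mx i i) + frobdot M (X *m delta_mx j j))
  - s * (frobdot M (X *m delta_mx i j) - frobdot M (X *m delta_mx j i)).
Proof.
have -> : (rot i j c s)^T = rot i j c (- s).
  rewrite /rot linearD linearD linearZ linearZ /= linearD linearB /= trmx1 !trmx_delta.
  by rewrite scaleNr -scalerN opprB.
rewrite /rot !mulmxDr mulmx1 addrAC [X + _]addrC addrK -!scalemxAr frobdotDr !frobdotZr.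
by rewrite mulmxBr mulmxDr frobdotDr frobdotBr; ring.
Qed.

(** Rotating only the space between two consecutive layers is always a symmetry, and it moves just
    these two layers. *)
Lemma orth_mid_bound l (i j : 'I_(d l.+1)) (I J : 'I_N) : (l < n.+1)%N -> i != j ->
  i = I :> nat -> j = J :> nat ->
  `|w l I J * α J - α I * w l.+1 I J - (w l J I * α I - α J * w l.+1 J I)| <=
  tau * (2^-1 + `|w l I I * α I + w l J J * α J + (α I * w l.+1 I I + α J * w l.+1 J J)|).
Proof.
move=> hl ij eI eJ; apply: first_order_circle => // c s cs.
have [P [Pl Pn]] := dep_update (fun l => 1%:M : 'M[R]_(d l)) (rot i j c s).
have o1 m : Defs.orthomx (1%:M : 'M[R]_m) by rewrite /Defs.orthomx trmx1 mulmx1.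
have hP : symmetry n y P.
  split=> [m hm|]; last by rewrite !Pn ?mul1mx ?mulmx1 //; lia.
  have [->|nm] := eqVneq m l.+1; first by rewrite Pl; apply: rot_ortho.
  by rewrite Pn.
apply: le_trans (near_rot hP).
rewrite (@sum_two_terms (fun l => frobdot (W' l) (P l.+1 *m S l *m (P l)^T - S l)) n.+2 l l.+1);
  [|lia|lia|lia|]; last first.
  move=> m hm n1 n2.
  by rewrite !Pn ?mul1mx ?trmx1 ?mulmx1 ?subrr ?frobdotE ?mulmx0 ?linear0 //; lia.
rewrite [P l]Pn; last by lia.
rewrite [P l.+2]Pn; last by lia.
rewrite Pl trmx1 mulmx1 mul1mx frobdot_rot_l frobdot_rot_r /S.
have d0 : (d l <= N)%N by apply: hN; lia.
have d1 : (d l.+1 <= N)%N by apply: hN; lia.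
have d2 : (d l.+2 <= N)%N by apply: hN; lia.
have k0 : (k <= d l)%N by apply: kd; lia.
have k1 : (k <= d l.+1)%N by apply: kd; lia.
have k2 : (k <= d l.+2)%N by apply: kd; lia.
have fl := fun i j I J => @frobdot_delta_l R N _ _ _ a (W' l) i j I J k1 k0 d1 d0.
have fr := fun i j I J => @frobdot_delta_r R N _ _ _ a (W' l.+1) i j I J k2 k1 d2 d1.
rewrite (fl _ _ _ _ eI eI) (fl _ _ _ _ eI eJ) (fl _ _ _ _ eJ eJ) (fl _ _ _ _ eJ eI).
rewrite (fr _ _ _ _ eI eI) (fr _ _ _ _ eI eJ) (fr _ _ _ _ eJ eJ) (fr _ _ _ _ eJ eI).
lra.
Qed.

Lemma rot_diagY p q (i j : 'I_q) (i' j' : 'I_p) c s :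
  i = i' :> nat -> j = j' :> nat -> y i = y j ->
  rot i' j' c s *m diagY p q y = diagY p q y *m rot i j c s.
Proof.
move=> ei ej eij.
have dl (u v : 'I_p) (v' : 'I_q) : v = v' :> nat ->
    delta_mx u v *m diagY p q y = y v *: (delta_mx u v' : 'M[R]_(p, q)).
  move=> ev; apply/matrixP => b e; rewrite !mxE (bigD1 v) //= !mxE eqxx andbT ev.
  rewrite big1 ?addr0 => [|z nz]; last by rewrite mxE (negPf nz) andbF mul0r.
  by rewrite (val_eqE v' e) [v' == e]eq_sym; case: (b == u); case: (e == v') => /=; ring.
have dr (u v : 'I_q) (u' : 'I_p) : u' = u :> nat ->
    diagY p q y *m delta_mx u v = y u *: (delta_mx u' v : 'M[R]_(p, q)).
  move=> eu; apply/matrixP => b e; rewrite !mxE (bigD1 u) //= !mxE eqxx /= -eu.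
  rewrite big1 ?addr0 => [|z nz]; last by rewrite !mxE (negPf nz) mulr0.
  rewrite (val_eqE b u'); case: eqP => [->|_] /=; last by ring.
  by case: (e == v) => /=; ring.
rewrite /rot !mulmxDl !mulmxDr mul1mx mulmx1 -!scalemxAl -!scalemxAr.
rewrite mulmxDl mulmxDr mulmxBl mulmxBr.
rewrite !(dl _ _ _ (esym ei)) !(dl _ _ _ (esym ej)) !(dr _ _ _ (esym ei)) !(dr _ _ _ (esym ej)).
by rewrite -ei -ej eij.
Qed.

(** The input and output spaces must rotate together to respect the target, which is possible in a
    plane where [y] is constant; only the first and last layers move. *)
Lemma orth_end_bound (i j : 'I_(d 0)) (i' j' : 'I_(d n.+2)) (I J : 'I_N) : i != j ->
  i = I :> nat -> j = J :> nat -> i' = I :> nat -> j' = J :> nat -> y I = y J ->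
  `|α J * w 0 J I - α I * w 0 I J - (w n.+1 J I * α I - w n.+1 I J * α J)| <=
  tau * (2^-1 + `|α I * w 0 I I + α J * w 0 J J +
     (w n.+1 I I * α I + w n.+1 J J * α J)|).
Proof.
move=> ij eI eJ eI' eJ' yIJ; apply: first_order_circle => // c s cs.
have [P1 [P1l P1n]] := dep_update (fun l => 1%:M : 'M[R]_(d l)) (rot i j c s).
have [P [Pl Pn]] := dep_update P1 (rot i' j' c s).
have P0 : P 0 = rot i j c s by rewrite Pn.
have Pm m : m != 0%N -> m != n.+2 -> P m = 1%:M by move=> h1 h2; rewrite Pn ?P1n.
have o1 m : Defs.orthomx (1%:M : 'M[R]_m) by rewrite /Defs.orthomx trmx1 mulmx1.
have ij' : i' != j' by rewrite -val_eqE /= eI' eJ' -eI -eJ.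
have hP : symmetry n y P.
  split=> [m hm|]; last by rewrite Pl P0; apply: rot_diagY; rewrite ?eI ?eJ ?eI' ?eJ'.
  have [->|nm] := eqVneq m n.+2; first by rewrite Pl; apply: rot_ortho.
  have [->|nm0] := eqVneq m 0%N; first by rewrite P0; apply: rot_ortho.
  by rewrite Pm.
apply: le_trans (near_rot hP).
rewrite (@sum_two_terms (fun l => frobdot (W' l) (P l.+1 *m S l *m (P l)^T - S l)) n.+2 0 n.+1) //;
  last first.
  move=> m hm n1 n2.
  by rewrite !Pm ?mul1mx ?trmx1 ?mulmx1 ?subrr ?frobdotE ?mulmx0 ?linear0 //; lia.
rewrite Pl P0 (Pm 1%N) // (Pm n.+1); [|lia|lia].
rewrite trmx1 mulmx1 mul1mx frobdot_rot_l frobdot_rot_r /S.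
have d0 : (d 0 <= N)%N by apply: hN.
have d1 : (d 1 <= N)%N by apply: hN.
have d2 : (d n.+1 <= N)%N by apply: hN; lia.
have d3 : (d n.+2 <= N)%N by apply: hN.
have k0 : (k <= d 0)%N by apply: kd.
have k1 : (k <= d 1)%N by apply: kd.
have k2 : (k <= d n.+1)%N by apply: kd; lia.
have k3 : (k <= d n.+2)%N by apply: kd.
have fl := fun i j I J => @frobdot_delta_l R N _ _ _ a (W' n.+1) i j I J k3 k2 d3 d2.
have fr := fun i j I J => @frobdot_delta_r R N _ _ _ a (W' 0) i j I J k1 k0 d1 d0.
rewrite (fl _ _ _ _ eI' eI') (fl _ _ _ _ eI' eJ') (fl _ _ _ _ eJ' eJ') (fl _ _ _ _ eJ' eI').
rewrite (fr _ _ _ _ eI eI) (fr _ _ _ _ eI eJ) (fr _ _ _ _ eJ eJ) (fr _ _ _ _ eJ eI).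
lra.
Qed.

End NearMinimizer.

(** * The local bound around an orbit, uniform over samples *)

Section LocalBound.
Context (R : realType) (n : nat) (d : nat -> nat) (lam : R) (y : nat -> R).
Local Notation k := (minn (d 0) (d n.+2)).
Local Notation ycol := (\col_(i < k) y i : 'cV[R]_k).
Hypotheses (lam_gt0 : 0 < lam)
  (y_ge0 : forall i : nat, (i < k)%N -> 0 <= y i)
  (kd : forall l, (l <= n.+2)%N -> (k <= d l)%N).
Context (a : 'cV[R]_k).
Hypotheses (hA : setA n.+2 lam y a)
  (nondeg_pos : forall i : 'I_k, 0 < a i 0 -> n.+2%:R * a i 0 ^+ (2 * n.+1) != n%:R * lam)
  (nondeg_zero : n = 0%N -> forall i, (i < k)%N -> 0 < y i -> lam != y i ^+ 2).

(* The index type of all [dom] statements: a constant in [dom] is uniform in [W], in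
   its gradient and in the orbit point. *)
Record sample := Sample {
  sW : wtuple R d;
  sG : wtuple R d;
  sU : forall l, 'M[R]_(d l);
  sU_sym : symmetry n y sU;
  sG_grad : is_grad n.+2 (Gobj d n lam y) sW sG;
  s_dist : 0 < tdist n.+2 sW (orbit_pt a sU) <= 1;
  s_near : forall U', symmetry n y U' ->
    tdist n.+2 sW (orbit_pt a sU) ^+ 2 - (tdist n.+2 sW (orbit_pt a sU) ^+ 2) ^+ 2
    <= tdist n.+2 sW (orbit_pt a U') ^+ 2 }.

Let N := \max_(l < n.+3) d l.
Let hN l : (l <= n.+2)%N -> (d l <= N)%N.
Proof. by move=> hl; apply: (leq_bigmax (Ordinal (hl : (l < n.+3)%N))). Qed.

Lemma tnorm_sqr (V : wtuple R d) : tnorm n.+2 V ^+ 2 = \sum_(l < n.+2) frob2 (V l).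
Proof. by rewrite sqr_sqrtr // sumr_ge0 // => l _; apply: frob2_ge0. Qed.

Lemma frob2_le_tnorm (V : wtuple R d) l : (l < n.+2)%N -> frob2 (V l) <= tnorm n.+2 V ^+ 2.
Proof.
move=> hl; rewrite tnorm_sqr (bigD1 (Ordinal hl)) //= lerDl.
by apply: sumr_ge0 => i _; apply: frob2_ge0.
Qed.

Lemma tnorm_ge0 (V : wtuple R d) : 0 <= tnorm n.+2 V.
Proof. exact: sqrtr_ge0. Qed.

Local Notation α i := (padv N a 0 i).
Let v : 'rV[R]_N := Num.sqrt lam *: padv N ycol.
Let h (t : sample) := tdist n.+2 (sW t) (orbit_pt a (sU t)).
Let delta (t : sample) := tnorm n.+2 (sG t) + h t ^+ 2.
Let W' (t : sample) l := (sU t l.+1)^T *m sW t l *m sU t l.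
Let w (t : sample) l := padm N (W' t l).
Let H (t : sample) l := padm N (W' t l - Sigmx (d l.+1) (d l) a).
Let g (t : sample) l := padm N ((sU t l.+1)^T *m sG t l *m sU t l).

Lemma padv_lt M (b : 'cV[R]_k) (i : 'I_M) (i' : 'I_k) : i = i' :> nat -> padv M b 0 i = b i' 0.
Proof. by move=> e; rewrite mxE (e : val i = val i') valK. Qed.

Let h_ge0 t : 0 <= h t. Proof. exact: tnorm_ge0. Qed.
Let h_le1 t : h t <= 1. Proof. by case/andP: (s_dist t). Qed.
Let h_sqr t : h t ^+ 2 <= delta t. Proof. by rewrite lerDr tnorm_ge0. Qed.

Let padv_case (P : 'I_N -> Prop) :
  (forall (i : 'I_N) (i' : 'I_k), i = i' :> nat -> P i) -> (forall i : 'I_N, (k <= i)%N -> P i) ->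
  forall i, P i.
Proof.
by move=> h1 h2 i; have [ik|ki] := ltnP i k; [apply: (h1 i (Ordinal ik))|apply: h2].
Qed.

Let alpha_ge0 (i : 'I_N) : 0 <= α i.
Proof.
elim/padv_case: i => [i i' e|i ki]; last by rewrite padv_ge.
by rewrite (padv_lt a e); case: (hA i').
Qed.

Let v_lt (i : 'I_N) (i' : 'I_k) : i = i' :> nat -> v 0 i = Num.sqrt lam * y i.
Proof. by move=> e; rewrite mxE (padv_lt _ e) mxE e. Qed.

Let v_ge (i : 'I_N) : (k <= i)%N -> v 0 i = 0.
Proof. by move=> e; rewrite mxE padv_ge // mulr0. Qed.

Let v_ge0 (i : 'I_N) : 0 <= v 0 i.
Proof.
elim/padv_case: i => [i i' e|i ki]; last by rewrite v_ge.
by rewrite (v_lt e) mulr_ge0 ?sqrtr_ge0 // e y_ge0.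
Qed.

Let crit (i : 'I_N) : α i ^+ n.+1 * (α i ^+ n.+2 - v 0 i) + lam * α i = 0.
Proof.
elim/padv_case: i => [i i' e|i ki].
  rewrite (padv_lt a e) (v_lt e) e; case: (hA i') => <- _.
  have -> : (2 * n.+2 - 1 = n.+1 + n.+2)%N by lia.
  by rewrite subn1 exprD; ring.
by rewrite padv_ge // expr0n mul0r mulr0 addr0.
Qed.

Let nd_pos (i : 'I_N) : 0 < α i -> n.+2%:R * α i ^+ (2 * n.+1) != n%:R * lam.
Proof.
elim/padv_case: i => [i i' e|i ki]; last by rewrite padv_ge // ltxx.
by rewrite (padv_lt a e); apply: nondeg_pos.
Qed.

Let nd_zero : n = 0%N -> forall i : 'I_N, lam ^+ 2 != v 0 i ^+ 2.
Proof.
move=> n0; elim/padv_case => [i i' e|i ki]; last first.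
  by rewrite v_ge // expr0n expf_neq0 // gt_eqF.
have l0 : lam != 0 by rewrite gt_eqF.
rewrite (v_lt e) exprMn sqr_sqrtr ?ltW // expr2 (inj_eq (mulfI l0)).
have ik : (i < k)%N by rewrite e.
have := y_ge0 ik; rewrite le_eqVlt => /orP[/eqP <-|yi]; last exact: nondeg_zero.
by rewrite expr0n gt_eqF.
Qed.

Let entry_le p q (A : 'M[R]_(p, q)) i j (c : R) : 0 <= c -> (p <= N)%N -> (q <= N)%N ->
  frob2 A <= c ^+ 2 -> `|padm N A i j| <= c.
Proof.
move=> c0 pN qN hA'; rewrite -(@ler_pXn2r _ 2) ?nnegrE // real_normK ?num_real //.
by apply: le_trans hA'; rewrite -(frob2_pad A pN qN); apply: frob2_entry.
Qed.

Let frob2_H t l : (l < n.+2)%N ->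
  frob2 (W' t l - Sigmx (d l.+1) (d l) a) = frob2 (sW t l - orbit_pt a (sU t) l).
Proof. by move=> hl; rewrite -(frob2_conj _ (sU_sym t)). Qed.

Let H_small l : (l < n.+2)%N -> mdom h (fun t => H t l).
Proof.
move=> hl i j; exists 1 => t; rewrite mul1r.
apply: entry_le => //; [exact: hN|exact/hN/ltnW|].
by rewrite frob2_H //; apply: (@frob2_le_tnorm (fun l => sW t l - orbit_pt a (sU t) l)).
Qed.

Let g_small l : (l < n.+2)%N -> mdom delta (fun t => g t l).
Proof.
move=> hl i j; exists 1 => t; rewrite mul1r.
apply: (@le_trans _ _ (tnorm n.+2 (sG t))); last by rewrite lerDl sqr_ge0.
apply: entry_le; [exact: tnorm_ge0|exact: hN|exact/hN/ltnW|].
have [oU _] := sU_sym t.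
rewrite frob2_ortho; [exact: frob2_le_tnorm|exact: oU|exact/oU/ltnW].
Qed.

Let wE t l : (l < n.+2)%N -> w t l = diag_mx (padv N a) + H t l.
Proof.
move=> hl; rewrite /H padB padm_Sigmx ?kd ?hN ?(ltnW hl) //.
by rewrite addrC subrK.
Qed.

Let gE t l : (l < n.+2)%N -> g t l =
  2 *: ((segw (w t) l.+1 (n.+1 - l))^T *m padres d n lam y (w t) *m (segw (w t) 0 l)^T
   + lam *: w t l).
Proof.
move=> hl; have [oU cU] := sU_sym t.
rewrite /g (pad_conj hN) // (grad_pad hN (sG_grad t)) //.
by rewrite -(padgrad_conj lam hN oU cU).
Qed.

Let EE t : padres d n lam y (w t) = segw (w t) 0 n.+2 - diag_mx v.
Proof.
rewrite /padres (@diagY_Sigmx _ _ _ k) // padm_Sigmx ?hN ?kd //.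
by congr (_ - _); apply/matrixP => i j; rewrite !mxE mulrnAr.
Qed.

Let w_bd l i j : (l < n.+2)%N -> dom (fun=> 1) (fun t => w t l i j).
Proof.
move=> hl.
have hH : mdom (fun=> 1) (fun t => H t l) := mdom_h_bd h_ge0 h_le1 (H_small hl).
have hw := mdomD (@mdom_cst _ sample _ _ (diag_mx (padv N a))) hH.
apply: (dom_ext (hw i j)) => t.
by rewrite wE.
Qed.

(** The rotation bounds are used with [tau] equal to [h t ^+ 2]; a bounded [A] then gives an error
    of order [h ^+ 2], which lies within [delta]. *)
Let near_dom (A B : sample -> R) : dom (fun=> 1) A ->
  (forall t, `|B t| <= h t ^+ 2 * (2^-1 + `|A t|)) -> dom delta B.
Proof.
move=> [C hC] hB; exists (2^-1 + C) => t; apply: (le_trans (hB t)).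
have hCt : `|A t| <= C by rewrite -[C]mulr1.
by rewrite mulrC ler_pM ?sqr_ge0 ?addr_ge0 ?invr_ge0 ?ler0n ?lerD2l.
Qed.

Let near_tnorm t U' : symmetry n y U' ->
  \sum_(l < n.+2) frob2 (sW t l - orbit_pt a (sU t) l) - (h t ^+ 2) ^+ 2 <=
  \sum_(l < n.+2) frob2 (sW t l - orbit_pt a U' l).
Proof.
move=> hU'; have := s_near t hU'.
by rewrite {1}/tdist tnorm_sqr /tdist [in X in _ <= X -> _]tnorm_sqr.
Qed.

Let tau_itv t : 0 < h t ^+ 2 <= 1.
Proof.
by have /andP[h0 h1] := s_dist t; rewrite exprn_gt0 // expr_le1 // ltW.
Qed.

Let wH_neq t l i j : (l < n.+2)%N -> i != j -> w t l i j = H t l i j.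
Proof. by move=> hl /negPf ne; rewrite wE // [LHS]mxE mxE ne mulr0n add0r. Qed.

Let alpha_out l (i : 'I_N) : (l <= n.+2)%N -> (d l <= i)%N -> α i = 0.
Proof. by move=> hl hi; rewrite padv_ge // (leq_trans (kd hl)). Qed.

Let orth_mid l i j : (l < n.+1)%N -> dom delta (fun t =>
  H t l i j * α j - α i * H t l.+1 i j - (H t l j i * α i - α j * H t l.+1 j i)).
Proof.
move=> hl; have hl1 : (l.+1 <= n.+2)%N by lia.
have [->|nij] := eqVneq i j; first by apply: (dom_ext (dom0 _)) => t; ring.
(* Padding indices outside the inner space admit no rotation, but there each term has a factor [α]
   or an entry of [H] that is zero. *)
have [jd|dj] := ltnP j (d l.+1); last first.
  apply: (dom_ext (dom0 _)) => t; rewrite (alpha_out hl1 dj).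
  by rewrite [H t l.+1 i j]pad_entry_col // [H t l j i]pad_entry_row //; ring.
have [id|di] := ltnP i (d l.+1); last first.
  apply: (dom_ext (dom0 _)) => t; rewrite (alpha_out hl1 di).
  by rewrite [H t l.+1 j i]pad_entry_col // [H t l i j]pad_entry_row //; ring.
pose A t := w t l i i * α i + w t l j j * α j + (α i * w t l.+1 i i + α j * w t l.+1 j j).
have hl0 : (l < n.+2)%N by lia.
apply: (@near_dom A).
  apply: domD; first by apply: (dom_lin2 (w_bd i i hl0) (w_bd j j hl0)) => t;
    rewrite mulrC [_ * α j]mulrC.
  by apply: (dom_lin2 (@w_bd l.+1 i i hl) (@w_bd l.+1 j j hl)) => t.
move=> t; have nji : j != i by rewrite eq_sym.
rewrite -!wH_neq //.
exact: (orth_mid_bound kd hN (sU_sym t) (tau_itv t) (near_tnorm t) hl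
  (i := Ordinal id) (j := Ordinal jd)).
Qed.

Let v_gt0 i : 0 < v 0 i -> (i < k)%N.
Proof. by rewrite ltnNge; case: (leqP k i) => // ki; rewrite v_ge // ltxx. Qed.

Let orth_end i j : 0 < v 0 i -> v 0 i = v 0 j -> dom delta (fun t =>
  α i * H t 0 i j - α j * H t 0 j i - (α j * H t n.+1 i j - α i * H t n.+1 j i)).
Proof.
move=> vi e; have ik := v_gt0 vi; have jk : (j < k)%N by apply: v_gt0; rewrite -e.
have [->|nij] := eqVneq i j; first by apply: (dom_ext (dom0 _)) => t; ring.
have nji : j != i by rewrite eq_sym.
have yij : y i = y j.
  move: e; rewrite (@v_lt i (Ordinal ik)) // (@v_lt j (Ordinal jk)) // => /mulfI; apply.
  by rewrite sqrtr_eq0 -ltNge.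
pose A t := α i * w t 0 i i + α j * w t 0 j j + (w t n.+1 i i * α i + w t n.+1 j j * α j).
have := @near_dom A (fun t => α j * w t 0 j i - α i * w t 0 i j -
   (w t n.+1 j i * α i - w t n.+1 i j * α j)).
have k0 := kd (leq0n n.+2); have kL := kd (leqnn n.+2).
move=> hd; apply: (dom_lin1 (c := -1) (hd _ _)) => [||t].
- apply: domD.
    by apply: (dom_lin2 (@w_bd 0 i i isT) (@w_bd 0 j j isT)) => t.
  by apply: (dom_lin2 (@w_bd n.+1 i i (ltnSn _)) (@w_bd n.+1 j j (ltnSn _))) => t;
    rewrite mulrC [_ * α j]mulrC.
- move=> t; exact: (orth_end_bound kd hN (sU_sym t) (tau_itv t) (near_tnorm t)
    (i := Ordinal (leq_trans ik k0)) (j := Ordinal (leq_trans jk k0))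
    (i' := Ordinal (leq_trans ik kL)) (j' := Ordinal (leq_trans jk kL))).
by rewrite -!wH_neq //; ring.
Qed.

Lemma sample_bound : exists C : R, forall t : sample,
  h t <= C * (tnorm n.+2 (sG t) + h t ^+ 2).
Proof.
have small l i j : (l < n.+2)%N -> dom delta (fun t => H t l i j).
  exact: (deviation_small h_ge0 h_le1 h_sqr lam_gt0 alpha_ge0 v_ge0 crit nd_pos nd_zero
    H_small g_small wE EE gE orth_mid orth_end).
(* Squares are compared, [h ^+ 2] being the sum of the squared entries, so that no root has to be
   bounded. *)
have : dom (fun t => delta t * delta t) (fun t => h t ^+ 2).
  apply: (dom_ext (f := fun t => \sum_(l < n.+2) \sum_i \sum_j H t l i j * H t l i j)).
    apply: dom_sum => l _; apply: dom_sum => i _; apply: dom_sum => j _.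
    by apply: domM; apply: small.
  move=> t; rewrite /h /tdist tnorm_sqr; apply: eq_bigr => l _.
  by rewrite -frob2_H // -(@frob2_pad _ N) ?hN // ltnW.
move=> [C hC]; exists (1 + `|C|) => t.
have d0 : 0 <= delta t by rewrite (le_trans _ (h_sqr t)) // sqr_ge0.
have C1 : 0 <= 1 + `|C| by rewrite addr_ge0.
rewrite -/(delta t) -(@ler_pXn2r _ 2) ?nnegrE ?(mulr_ge0 C1 d0) //.
have := hC t; rewrite ger0_norm ?sqr_ge0 // => /le_trans; apply.
rewrite exprMn -expr2 ler_wpM2r ?sqr_ge0 //.
have := normr_ge0 C; have := ler_norm C; move: `|C| => c h1 h2.
by nra.
Qed.

End LocalBound.

(** * From the excluded values of [lam] to simple roots *)

Section Nondegeneracy.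
Context (R : realType).

Lemma powR_natM (x e : R) m : 0 <= x -> x `^ (m%:R * e) = (x `^ e) ^+ m.
Proof. by move=> x0; rewrite mulrC powRrM powR_mulrn ?powR_ge0. Qed.

Lemma powR_invl (x e : R) : 0 <= x -> x^-1 `^ e = (x `^ e)^-1.
Proof. by move=> x0; rewrite -powR_inv1 // -powRrM mulN1r powRN. Qed.

(* Dividing the critical equation by [a ^+ n.+1] turns it into
   [a ^+ n.+2 + lam / a ^+ n = Num.sqrt lam * y]; the left-hand side has its only
   critical point at [a ^+ (2 * n.+1) = lam * n / n.+2], where the resulting
   relation between [lam] and [y] is the excluded one. *)
Lemma critical_nondegenerate n (lam y a : R) : 0 < lam -> 0 < a ->
  a ^+ (2 * n.+2 - 1) - Num.sqrt lam * y * a ^+ (n.+2 - 1) + lam * a = 0 ->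
  ((1 <= n)%N -> lam != y ^+ (2 * n.+1) /
       ((((n%:R / n.+2%:R) `^ (n.+2%:R / (2 * n.+1)%:R))
        + ((n.+2%:R / n%:R) `^ (n%:R / (2 * n.+1)%:R))) ^+ (2 * n.+1))) ->
  n.+2%:R * a ^+ (2 * n.+1) != n%:R * lam.
Proof.
move=> lam0 a0 crit hl; apply/eqP => e.
have [n0|n_gt0] := posnP n.
  move/eqP: e; rewrite n0 mul0r mulf_eq0 expf_eq0 /= (gt_eqF a0) orbF.
  by rewrite pnatr_eq0.
move/eqP: (hl n_gt0); apply.
set q : R := n%:R / n.+2%:R; set m := (2 * n.+1)%N.
have n0 : (0 : R) < n%:R by rewrite ltr0n.
have n2 : (0 : R) < n.+2%:R by rewrite ltr0n.
have q0 : 0 < q by rewrite divr_gt0.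
have m0 : (m%:R : R) != 0 by rewrite pnatr_eq0.
(* With [rho ^+ m = n / n.+2], both real powers in the hypothesis become integer powers of [rho] or
   of its inverse. By [e], [mu = a / rho] satisfies [mu ^+ m = lam], and the critical equation gives
   [y] as [mu] times the bracket, which is the excluded relation. *)
pose rho := q `^ m%:R^-1.
have rho0 : 0 < rho by rewrite powR_gt0.
have rhom : rho ^+ m = q by rewrite -powR_natM ?ltW // mulfV // powRr1 // ltW.
have -> : n.+2%:R / n%:R = q^-1 by rewrite /q invf_div.
rewrite powR_invl ?ltW // !powR_natM ?ltW // -/rho.
pose mu := a / rho.
have mu0 : 0 < mu by rewrite divr_gt0.
have am : a = mu * rho by rewrite /mu divfK // gt_eqF.
have mum : mu ^+ m = lam.
  rewrite expr_div_n rhom /q invf_div mulrA [_ * n.+2%:R]mulrC e mulrAC mulfV ?mul1r //.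
  by rewrite gt_eqF.
clearbody mu.
have sl : Num.sqrt lam = mu ^+ n.+1.
  by rewrite -mum /m mulnC exprM sqrtr_sqr ger0_norm // exprn_ge0 // ltW.
have yE : y = mu * (rho ^+ n.+2 + (rho ^+ n)^-1).
  have nz : mu ^+ n.+1 * a ^+ n.+1 != 0 by rewrite mulf_neq0 // expf_neq0 // gt_eqF.
  apply: (mulfI nz).
  have -> : mu ^+ n.+1 * a ^+ n.+1 * y = a ^+ (2 * n.+2 - 1) + lam * a.
    have e1 : (n.+2 - 1 = n.+1)%N by lia.
    by move: crit; rewrite sl e1 => /eqP; rewrite addrAC subr_eq0 => /eqP ->; ring.
  have -> : (2 * n.+2 - 1 = m.+1)%N by rewrite /m; lia.
  have rn0 : rho ^+ n != 0 by rewrite expf_neq0 // gt_eqF.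
  rewrite -mum am !exprMn /m mul2n -addnn !exprS !exprD !exprS.
  by field.
have c0 : rho ^+ n.+2 + (rho ^+ n)^-1 != 0.
  by rewrite gt_eqF // addr_gt0 ?invr_gt0 ?exprn_gt0.
by rewrite yE exprMn mulfK ?mum // expf_neq0.
Qed.

End Nondegeneracy.

(* L = n.+2 layers (L >= 2). *)
Theorem theorem3p11 (R : realType) (n : nat) (d : nat -> nat) (lam : R) (y : nat -> R)
  (lam_gt0 : 0 < lam)
  (y_sorted : forall i j : nat, (i <= j < minn (d 0) (d n.+2))%N -> y j <= y i)
  (y_ge0 : forall i : nat, (i < minn (d 0) (d n.+2))%N -> 0 <= y i)
  (hd : forall l : nat, (1 <= l <= n.+1)%N -> (minn (d 0) (d n.+2) <= d l)%N)
  (hlam2 : n = 0%N -> forall i : nat, (i < rY (minn (d 0) (d n.+2)) y)%N -> lam != y i ^+ 2)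
  (hlam3 : (1 <= n)%N -> forall i : nat, (i < rY (minn (d 0) (d n.+2)) y)%N ->
     lam != y i ^+ (2 * n.+1) /
       ((((n%:R / n.+2%:R) `^ (n.+2%:R / (2 * n.+1)%:R))
        + ((n.+2%:R / n%:R) `^ (n%:R / (2 * n.+1)%:R))) ^+ (2 * n.+1)))
  (sig : 'cV[R]_(minn (d 0) (d n.+2)))
  (hsig : setAsort n.+2 lam y sig) (hsig0 : sig != 0) :
  exists eps kappa : R, 0 < eps /\ 0 < kappa /\
    forall W : wtuple R d,
      dist_set n.+2 W (setWsig d n lam y sig) <= eps ->
      forall Gr : wtuple R d, is_grad n.+2 (Gobj d n lam y) W Gr ->
        dist_set n.+2 W (setWsig d n lam y sig) <= kappa * tnorm n.+2 Gr.
Proof.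
set k := minn (d 0) (d n.+2) in y_sorted y_ge0 hd hlam2 hlam3 sig hsig hsig0 *.
have kd : forall l, (l <= n.+2)%N -> (k <= d l)%N by move=> l; apply: dmin_le.
pose av (s : {perm 'I_k}) : 'cV[R]_k := (perm_mx s)^T *m sig.
pose sdist s (t : @sample R n d lam y (av s)) := tdist n.+2 (sW t) (orbit_pt (av s) (sU t)).
(* The constant is chosen before criticality is assumed, so that [choice] applies; permutations
   giving no critical vector get the dummy value 0. *)
have bound s : exists C : R, setA n.+2 lam y (av s) -> forall t : @sample R n d lam y (av s),
    sdist s t <= C * (tnorm n.+2 (sG t) + sdist s t ^+ 2).
  have [hA|nA] := pselect (setA n.+2 lam y (av s)); last by exists 0.
  have nd_pos (i : 'I_k) : 0 < av s i 0 -> n.+2%:R * av s i 0 ^+ (2 * n.+1) != n%:R * lam.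
    move=> ai; have [crit _] := hA i; apply: (critical_nondegenerate lam_gt0 ai crit) => n0.
    (* The hypothesis on [lam] concerns positive [y i] only; if [y i] were zero, the critical
       equation would be a vanishing sum of positive terms. *)
    apply: hlam3 => //; rewrite lt_rY // lt_def y_ge0 // andbT; apply/eqP => yi.
    move/eqP: crit; rewrite yi mulr0 mul0r subr0 gt_eqF //.
    by rewrite addr_gt0 ?mulr_gt0 ?exprn_gt0.
  have nd_zero : n = 0%N -> forall i, (i < k)%N -> 0 < y i -> lam != y i ^+ 2.
    by move=> n0 i ik yi; apply: hlam2 => //; rewrite lt_rY.
  have [C hC] := sample_bound lam_gt0 y_ge0 kd hA nd_pos nd_zero.
  by exists C.
have [Cs hCs] := choice bound.
(* One constant for all permutations; the summand 1 makes it at least 1, hence [D <= 1 / 4]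
   below. *)
pose C : R := 1 + \sum_s `|Cs s|.
have C1 : 1 <= C by rewrite lerDl sumr_ge0.
have CsC s : Cs s <= C.
  rewrite /C (bigD1 s) //= addrCA (le_trans (ler_norm _)) // lerDl addr_ge0 //.
  by rewrite sumr_ge0.
have C0 : 0 < C by lra.
(* Since [h <= 2 * D], this radius gives [C * h <= 1 / 2]: the quadratic term takes at most half of
   [h], and the other half yields the factor [2 * C]. *)
exists ((4 * C)^-1), (2 * C); split; first by rewrite invr_gt0; lra.
split; first by lra.
move=> W hW Gr hGr; set D := dist_set _ _ _ in hW *.
have td0 (V : wtuple R d) : 0 <= tdist n.+2 W V := tnorm_ge0 _ _.
have lbd : has_lbound [set tdist n.+2 W V | V in setWsig d n lam y sig].
  by exists 0 => _ [V _ <-].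
have oneU : symmetry n y (fun l => 1%:M : 'M[R]_(d l)).
  split=> [l _|]; last by rewrite mul1mx mulmx1.
  by rewrite /Defs.orthomx trmx1 mulmx1.
have nonempty : [set tdist n.+2 W V | V in setWsig d n lam y sig] !=set0.
  have [a [s [hA [es _]]]] := hsig.
  have ea : (perm_mx s)^T *m sig = a.
    by rewrite es mulmxA ortho_trl ?mul1mx //; apply: perm_ortho.
  exists (tdist n.+2 W (orbit_pt a (fun l => 1%:M))), (orbit_pt a (fun l => 1%:M)) => //.
  by apply/setWsigP => //; exists s, (fun l => 1%:M); rewrite ea; split.
have D_le V : setWsig d n lam y sig V -> D <= tdist n.+2 W V.
  by move=> hV; apply: ge_inf => //; exists V.
have D_ge0 : 0 <= D by apply: lb_le_inf => // _ [V _ <-].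
have G0 : 0 <= tnorm n.+2 Gr := tnorm_ge0 _ _.
(* A sample requires a positive distance; for [D = 0] the bound is trivial. *)
have [->|D_neq0] := eqVneq D 0; first by rewrite mulr_ge0 //; lra.
have D_gt0 : 0 < D by rewrite lt_def D_neq0.
have D14 : D <= 4^-1.
  apply: (le_trans hW); rewrite lef_pV2 ?posrE; lra.
(* An excess of [D^3 / 3] over the infimum gives [h^2 <= D^2 + 2/3 D^4 + D^6 / 9], at most
   [D^2 + D^4] as [D <= 1], hence at most [D^2 + h^4]: exactly the slack of a sample. *)
have D3 : 0 < D ^+ 3 / 3 by rewrite divr_gt0 ?exprn_gt0.
have [_ [V hV <-] hVD] := inf_adherent D3 (conj nonempty lbd).
rewrite -/(dist_set n.+2 W (setWsig d n lam y sig)) -/D in hVD.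
have DV := D_le V hV.
have [s [U [hA sU eV]]] := (setWsigP lam y_sorted y_ge0 hd sig V).1 hV.
have eT : tdist n.+2 W V = tdist n.+2 W (orbit_pt (av s) U).
  by congr (Num.sqrt _); apply: eq_bigr => l _; rewrite eV.
rewrite eT in hVD DV; set h := tdist _ _ _ in hVD DV.
have h_le : h <= 2 * D.
  have : D ^+ 3 / 3 <= D by rewrite !exprS expr0; nra.
  lra.
have hdist : 0 < h <= 1 by apply/andP; split; lra.
have near U' : symmetry n y U' ->
    h ^+ 2 - (h ^+ 2) ^+ 2 <= tdist n.+2 W (orbit_pt (av s) U') ^+ 2.
  move=> sU'; have DU' : D <= tdist n.+2 W (orbit_pt (av s) U').
    by apply: D_le; apply/setWsigP => //; exists s, U'.
  apply: (@le_trans _ _ (D ^+ 2)); last by rewrite lerXn2r ?nnegrE.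
  have h2 : h ^+ 2 <= (D + D ^+ 3 / 3) ^+ 2 by rewrite lerXn2r ?nnegrE //; lra.
  have h4 : (D ^+ 2) ^+ 2 <= (h ^+ 2) ^+ 2.
    by rewrite -!exprM lerXn2r ?nnegrE //; lra.
  have D6 : D ^+ 6 <= D ^+ 4.
    by apply: ler_wiXn2l => //; lra.
  have D4 : 0 <= D ^+ 4 by rewrite exprn_ge0.
  have -> : D ^+ 2 = (D + D ^+ 3 / 3) ^+ 2 - 2 / 3 * D ^+ 4 - D ^+ 6 / 9 by field.
  move: h4; rewrite -exprM => h4; lra.
pose t := @Sample _ _ _ _ _ _ W Gr U sU hGr hdist near.
have hb : h <= C * (tnorm n.+2 Gr + h ^+ 2).
  apply: (le_trans (hCs s hA t)); rewrite ler_wpM2r //.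
  by rewrite addr_ge0 // sqr_ge0.
have Ch : C * h ^+ 2 <= h / 2.
  have hC : h * C <= 2^-1.
    apply: (@le_trans _ _ (2 * (4 * C)^-1 * C)).
      by rewrite ler_pM2r //; lra.
    by have -> : 2 * (4 * C)^-1 * C = 2^-1 by field; rewrite gt_eqF.
  have h0 : 0 <= h by lra.
  by rewrite expr2 mulrA [C * h]mulrC [leRHS]mulrC ler_wpM2r.
by apply: (le_trans DV); lra.
Qed.
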